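(* Let $-\infty<a<b<\infty$, $\Omega=(a,b)$, $\overline{\Omega}=[a,b]$, $0<\mu<1$, and let $t>1+\mu$ be given. Then there exist $\alpha,\beta,f,p,q,k$ satisfying (i) $0<\alpha,\beta<1$, $\alpha+\beta=1$; (ii) $f\in H^*(\Omega)$, $p,q,k\in C^1(\overline{\Omega})$, $p',k'\in H(\overline{\Omega})$; (iii) $k(x)>0$ on $\overline{\Omega}$ and $\frac{q}{k}-\frac12\left(\frac{p}{k}\right)'\ge 0$ on $\overline{\Omega}$; (iv) $\pi(1-\mu^2)\cot\left(\frac{(1+\mu)\pi}{2}\right)+4(b-a)\left\|\frac{k'}{k}\right\|_{L^\infty(\Omega)}<0$, and a true solution $u$ of the problem $$[L(u)](x)=f(x),\ x\in\Omega,\qquad u(a)=u(b)=0,$$ $$[L(u)](x):=-D\Big(k(x)\big(\alpha\,{_aD_x^{-(1-\mu)}}+\beta\,{_xD_b^{-(1-\mu)}}\big)Du\Big)+p(x)Du+q(x)u(x),$$ such that $u\ne {_aD_x^{-t}}J_t$ for every $J_t\in H^*(\Omega)$.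
   Context: All functions are real-valued. $D$ and $'$ denote the usual derivative; $AC(\overline{\Omega})$ is the set of absolutely continuous functions on $\overline{\Omega}$; $C^n(G)$ is the set of functions $f$ with $f^{(n)}$ continuous on $G$. Fractional integrals: for $\sigma>0$, $({_aD_x^{-\sigma}}w)(x)=\frac1{\Gamma(\sigma)}\int_a^x(x-s)^{\sigma-1}w(s)\,ds$ and $({_xD_b^{-\sigma}}w)(x)=\frac1{\Gamma(\sigma)}\int_x^b(s-x)^{\sigma-1}w(s)\,ds$. Hölder-type spaces: $H^\lambda(\overline{\Omega})$ is the space of Hölder continuous functions of order $\lambda$ on $\overline{\Omega}$; $H(\overline{\Omega})=\bigcup_{\lambda>0}H^\lambda(\overline{\Omega})$; $H^\lambda_0(\overline{\Omega})=\{f\in H^\lambda(\overline{\Omega}):f(a)=f(b)=0\}$; $H^\lambda_0(\epsilon_1,\epsilon_2)=\{f: f(x)=\frac{g(x)}{(x-a)^{1-\epsilon_1}(b-x)^{1-\epsilon_2}},\ g\in H^\lambda_0(\overline{\Omega})\}$; $H^*(\Omega)=\bigcup_{0<\lambda\le1,\ \epsilon_1,\epsilon_2>0}H^\lambda_0(\epsilon_1,\epsilon_2)$. True (classical) solution: $u$ is a true solution of the problem if $u\in AC(\overline{\Omega})$, $u(a)=u(b)=0$, $Du\in C(\Omega)$, $(\alpha\,{_aD_x^{-(1-\mu)}}+\beta\,{_xD_b^{-(1-\mu)}})Du\in C^1(\Omega)$ and $[L(u)](x)=f(x)$ for all $x\in\Omega$. *)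

(* Defs.v *)
From HB Require Import structures.
From mathcomp Require Import all_boot all_order all_algebra.
From mathcomp Require Import all_classical all_reals all_analysis.
Set Implicit Arguments.
Unset Strict Implicit.
Unset Printing Implicit Defensive.
Import Order.TTheory GRing.Theory Num.Theory.
Import numFieldNormedType.Exports.
Local Open Scope classical_set_scope.
Local Open Scope ring_scope.

Section FractionalDiffusion.
Context {R : realType}.
Implicit Types (f g u w p q k : R -> R) (a b x t : R) (G : set R).

(** Functions on an interval are represented by total functions [R -> R]; every
    notion below depends only on the values on the relevant interval. *)

Definition cot x : R := cos x / sin x.

Definition Gamma (s : R) : R :=
  \int[lebesgue_measure]_(y in `]0, +oo[) (y `^ (s - 1) * expR (- y)).

(** Derivative relative to [G]: the difference quotient is taken along points
    of [G] only, so that it is the one-sided derivative at an endpoint of a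
    closed interval. In the interior of [G] it is the usual derivative, see
    [derivable_withinE] and [derive_withinE]. *)
Definition derivable_within G f x : Prop :=
  cvg ((f y - f x) / (y - x) @[y --> within G x^']).

Definition derive_within G f x : R :=
  lim ((f y - f x) / (y - x) @[y --> within G x^']).

Definition C1_on G : set (R -> R) :=
  [set f | (forall x, G x -> derivable_within G f x)
           /\ {within G, continuous (derive_within G f)}].

Definition absolutely_continuous a b : set (R -> R) :=
  [set f | forall e : R, 0 < e -> exists2 d : R, 0 < d &
    forall (n : nat) (l r : 'I_n -> R),
      (forall i, [/\ a <= l i, l i <= r i & r i <= b]) ->
      trivIset setT (fun i => `]l i, r i[%classic) ->
      \sum_(i < n) (r i - l i) < d ->
      \sum_(i < n) `|f (r i) - f (l i)| < e].

(** In [frac_flux] these are applied to [derive1 u], whose value at the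
    endpoint of the range of integration is irrelevant (a null set). *)
Definition fracint_left a (s : R) w x : R :=
  (Gamma s)^-1 *
  \int[lebesgue_measure]_(y in `[a, x]) ((x - y) `^ (s - 1) * w y).

Definition fracint_right b (s : R) w x : R :=
  (Gamma s)^-1 *
  \int[lebesgue_measure]_(y in `[x, b]) ((y - x) `^ (s - 1) * w y).

Definition holder_order a b (l : R) : set (R -> R) :=
  [set f | exists C : R, forall x y, x \in `[a, b] -> y \in `[a, b] ->
    `|f x - f y| <= C * `|x - y| `^ l].

Definition holder a b : set (R -> R) :=
  [set f | exists2 l : R, 0 < l & holder_order a b l f].

Definition holder_order0 a b (l : R) : set (R -> R) :=
  [set f | [/\ holder_order a b l f, f a = 0 & f b = 0]].

Definition holder_weighted a b (l e1 e2 : R) : set (R -> R) :=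
  [set f | exists2 g, holder_order0 a b l g &
    forall x, x \in `]a, b[ ->
      f x = g x / ((x - a) `^ (1 - e1) * (b - x) `^ (1 - e2))].

(** The quotient defining [holder_weighted] is meaningless at the endpoints, so
    a member of [Hstar] is constrained on ]a, b[ only. *)
Definition Hstar a b : set (R -> R) :=
  [set f | exists l e1 e2 : R,
    [/\ 0 < l <= 1, 0 < e1, 0 < e2 & holder_weighted a b l e1 e2 f]].

(** The norm of L^oo(a, b), as an extended real number. *)
Definition Linfty_norm a b f : \bar R :=
  'N[mrestr lebesgue_measure (measurable_itv `]a, b[)]_(+oo%E)[EFin \o f].

Definition frac_flux a b (mu alpha beta : R) u x : R :=
  alpha * fracint_left a (1 - mu) (derive1 u) x
  + beta * fracint_right b (1 - mu) (derive1 u) x.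

Definition frac_operator a b (mu alpha beta : R) k p q u x : R :=
  - derive1 (k \* frac_flux a b mu alpha beta u) x
  + p x * derive1 u x + q x * u x.

Definition true_solution a b (mu alpha beta : R) k p q f u : Prop :=
  [/\ absolutely_continuous a b u,
      u a = 0 /\ u b = 0,
      (forall x, x \in `]a, b[ -> derivable u x 1)
        /\ {within `]a, b[, continuous (derive1 u)},
      C1_on `]a, b[ (frac_flux a b mu alpha beta u) &
      forall x, x \in `]a, b[ ->
        frac_operator a b mu alpha beta k p q u x = f x].

Lemma within_interior_dnbhs G x : nbhs x G -> within G x^' = x^'.
Proof.
move=> Gx; apply/seteqP; split => A.
  move=> /= H; change (nbhs x (fun y => y != x -> A y)).
  have {}H : nbhs x (fun y => y != x -> G y -> A y) by exact: H.
  by apply: filterS (filterI Gx H) => y [Gy yA] yx; exact: yA.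
move=> /= H; change (nbhs x (fun y => y != x -> G y -> A y)).
have {}H : nbhs x (fun y => y != x -> A y) by exact: H.
by apply: filterS H => y + yx; move=> /(_ yx).
Qed.

Lemma quotient_shift f x :
  (f y - f x) / (y - x) @[y --> x^'] =
  h^-1 *: (f (h *: 1 + x) - f x) @[h --> 0^'].
Proof.
have shiftE (P : set R) : nbhs x P = nbhs 0 (P \o shift x).
  by have := near_shift 0 x P; rewrite subr0.
have quotE h : (f (h + x) - f x) / (h + x - x) =
    h^-1 *: (f (h *: 1 + x) - f x).
  by rewrite addrK /GRing.scale /= mulr1 mulrC.
have neqE h : (h + x != x) = (h != 0) by rewrite -subr_eq0 addrK.
apply/seteqP; split => A.
  move=> /= H; have {}H : nbhs x (fun y => y != x ->
    A ((f y - f x) / (y - x))) by exact: H.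
  change (nbhs 0 (fun h : R => h != 0 -> A (h^-1 *: (f (h *: 1 + x) - f x)))).
  move: H; rewrite shiftE; apply: filterS => h /=.
  by rewrite quotE neqE.
move=> /= H; have {}H : nbhs 0 (fun h : R => h != 0 ->
  A (h^-1 *: (f (h *: 1 + x) - f x))) by exact: H.
change (nbhs x (fun y => y != x -> A ((f y - f x) / (y - x)))).
rewrite shiftE; apply: filterS H => h /=.
by rewrite quotE neqE.
Qed.

Lemma derivable_withinE G f x :
  nbhs x G -> derivable_within G f x <-> derivable f x 1.
Proof.
by move=> Gx; rewrite /derivable_within within_interior_dnbhs// quotient_shift.
Qed.

Lemma derive_withinE G f x : nbhs x G -> derive_within G f x = derive1 f x.
Proof.
move=> Gx.
by rewrite derive1E /derive_within within_interior_dnbhs// quotient_shift.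
Qed.

End FractionalDiffusion.

(* Main.v *)
(** Take [k = 1], [p = q = 0] and [alpha = beta = 1/2]. For exponents
    [P + Q = 1 + mu] with [mu < P < min(t - 1, (1 + mu)/2)], let
    [w(P, Q)(x) = (x - a)^(P-1) (b - x)^(Q-1)]. Since the exponents of
    [(x - y)^(-mu) w(P, Q)(y)] add up to [-1], differentiating the left
    fractional integral of [w(P, Q)] lowers that sum to [-2], where a Moebius
    substitution evaluates the integral: the derivative is a constant multiple
    of [w(1-Q, 1-P)]. The solution is the primitive [u] of
    [w(P, Q) - w(Q, P)], which is antisymmetric about the midpoint, so that [u]
    vanishes at both ends and the right fractional integral is the reflection
    of the left one. Hence [f] is a combination of [w(1-Q, 1-P)] and
    [w(1-P, 1-Q)], which lies in [H*] because [P, Q < 1]. Near [a], [u] is at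
    least [c (x - a)^P], whereas a fractional integral of order [t] of an
    element of [H*] is [O((x - a)^(t-1+e))] for some [e > 0]; as [P <= t - 1],
    [u] is not such an integral. *)

Require Import Defs.
From mathcomp Require Import all_boot all_order all_algebra.
From mathcomp Require Import all_classical all_reals all_analysis.
From mathcomp Require Import measurable_realfun ess_sup_inf ring lra.
Import Order.TTheory GRing.Theory Num.Theory.
Import numFieldNormedType.Exports.
Local Open Scope classical_set_scope.
Local Open Scope ring_scope.

Set Implicit Arguments.
Unset Strict Implicit.
Unset Printing Implicit Defensive.

(** * Improper integrals on open intervals *)

Section Improper.
Context {R : realType}.
Implicit Types (f g F G : R -> R) (a b c d x y : R).
Local Notation mu := lebesgue_measure.

(** The divisor starts at 3 so that [inner_left] is strictly below [inner_right] already for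
    [n = 0]. *)
Definition inner_left c d (n : nat) : R := c + (d - c) / n.+3%:R.
Definition inner_right c d (n : nat) : R := d - (d - c) / n.+3%:R.

Lemma inner_lt c d n : c < d ->
  [/\ c < inner_left c d n, inner_left c d n < inner_right c d n
    & inner_right c d n < d].
Proof.
move=> cd; rewrite /inner_left /inner_right.
have dc : 0 < d - c by rewrite subr_gt0.
have n3 : (n.+3%:R : R)^-1 <= 3^-1.
  by rewrite lef_pV2 ?posrE ?ltr0n// ler_nat.
have n0 : 0 < (n.+3%:R : R)^-1 by rewrite invr_gt0 ltr0n.
have h0 := mulr_gt0 dc n0.
have h1 : (d - c) / n.+3%:R <= (d - c) / 3 by rewrite ler_wpM2l// ltW.
by move: h0 h1; set z := (d - c) / n.+3%:R => h0 h1; split; lra.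
Qed.

Lemma inner_step_le c d n m : c < d -> (n <= m)%N ->
  (d - c) / m.+3%:R <= (d - c) / n.+3%:R.
Proof.
move=> cd nm; rewrite ler_wpM2l//; first by rewrite subr_ge0 ltW.
by rewrite lef_pV2 ?posrE ?ltr0n// ler_nat !ltnS.
Qed.

Lemma cvg_inner_step c d : (d - c) / n.+3%:R @[n --> \oo] --> (0 : R).
Proof.
rewrite -[X in _ --> X](mulr0 (d - c)); apply: cvgMl_tmp.
have := @cvg_harmonic R; rewrite -(cvg_shiftn 2%N)/=.
by under eq_fun do rewrite addn2.
Qed.

Lemma cvg_inner_left c d : inner_left c d n @[n --> \oo] --> c.
Proof.
rewrite -[X in _ --> X](addr0 c); apply: cvgD; first exact: cvg_cst.
exact: cvg_inner_step.
Qed.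

Lemma cvg_inner_right c d : inner_right c d n @[n --> \oo] --> d.
Proof.
rewrite -[X in _ --> X](subr0 d); apply: cvgB; first exact: cvg_cst.
exact: cvg_inner_step.
Qed.

Lemma oo_continuous_measurable c d f : {in `]c, d[, continuous f} ->
  measurable_fun `]c, d[ f.
Proof.
move=> cf; apply: open_continuous_measurable_fun; first exact: interval_open.
by move=> x /[!inE] xcd; apply: cf.
Qed.

(* The library's FTC and substitution lemmas need continuity on a closed
   interval; exhaustion from inside removes this restriction for integrands
   that are singular at the endpoints. *)
Lemma ge0_exhaust_cvg c d f (u v : nat -> R) :
  {homo u : n m / (n <= m)%N >-> m <= n} ->
  {homo v : n m / (n <= m)%N >-> n <= m} ->
  (forall n, c < u n) -> (forall n, v n < d) ->
  u n @[n --> \oo] --> c -> v n @[n --> \oo] --> d ->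
  {in `]c, d[, continuous f} -> (forall x, x \in `]c, d[ -> 0 <= f x) ->
  (\int[mu]_(x in `[u n, v n]) (f x)%:E)%E @[n --> \oo]
    --> (\int[mu]_(x in `]c, d[) (f x)%:E)%E.
Proof.
move=> du iv cu vd uc vdd cf f0.
have sub n x : x \in `[u n, v n] -> x \in `]c, d[.
  rewrite !in_itv/= => /andP[ux xv].
  by rewrite (lt_le_trans (cu n) ux) (le_lt_trans xv (vd n)).
have -> : `]c, d[%classic = \bigcup_n `[u n, v n]%classic.
  apply/seteqP; split => x /=; last by case=> n _ /=; exact: sub.
  rewrite in_itv/= => /andP[cx xd].
  have := cvgr_lt c uc x cx; have := cvgr_gt d vdd x xd.
  move=> H1 H2; near \oo => n; exists n => //=; rewrite in_itv/=.
  by apply/andP; split; apply/ltW; near: n; [exact: H2|exact: H1].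
apply: (@ge0_nondecreasing_set_cvg_integral _ (measurableTypeR R) R
  (fun n => `[u n, v n]%classic) (EFin \o f) mu).
- apply/nondecreasing_seqP => n; rewrite subsetEset => x /=.
  rewrite !in_itv/= => /andP[ux xv].
  rewrite (le_trans (du _ _ (leqnSn n)) ux).
  by rewrite (le_trans xv (iv _ _ (leqnSn n))).
- by move=> n; exact: measurable_itv.
- move=> n; apply/measurable_EFinP.
  apply: (@measurable_funS _ _ _ _ `]c, d[%classic) => //; first exact: sub.
  exact: oo_continuous_measurable.
- by move=> n x /= xuv; rewrite lee_fin f0// (sub n).
Unshelve. all: by end_near. Qed.

Lemma inner_exhaust_cvg c d f : c < d ->
  {in `]c, d[, continuous f} -> (forall x, x \in `]c, d[ -> 0 <= f x) ->
  (\int[mu]_(x in `[inner_left c d n, inner_right c d n]) (f x)%:E)%E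
    @[n --> \oo] --> (\int[mu]_(x in `]c, d[) (f x)%:E)%E.
Proof.
move=> cd cf f0; apply: ge0_exhaust_cvg => //.
- by move=> n m nm; rewrite lerD2l inner_step_le.
- by move=> n m nm; rewrite lerD2l lerN2 inner_step_le.
- by move=> n; case: (inner_lt n cd).
- by move=> n; case: (inner_lt n cd).
- exact: cvg_inner_left.
- exact: cvg_inner_right.
Qed.

Lemma inner_sub c d n x : c < d ->
  x \in `[inner_left c d n, inner_right c d n] -> x \in `]c, d[.
Proof.
move=> cd; have [h1 h2 h3] := inner_lt n cd.
rewrite !in_itv/= => /andP[ux xv].
by rewrite (lt_le_trans h1 ux) (le_lt_trans xv h3).
Qed.

Lemma cvg_comp_inner_left c d F (l : R) : c < d -> F x @[x --> c^'+] --> l ->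
  F (inner_left c d n) @[n --> \oo] --> l.
Proof.
move=> cd /cvg_at_rightP; apply; split; last exact: cvg_inner_left.
by move=> n; case: (inner_lt n cd).
Qed.

Lemma cvg_comp_inner_right c d F (l : R) : c < d -> F x @[x --> d^'-] --> l ->
  F (inner_right c d n) @[n --> \oo] --> l.
Proof.
move=> cd /cvg_at_leftP; apply; split; last exact: cvg_inner_right.
by move=> n; case: (inner_lt n cd).
Qed.

Lemma oo_continuous_within c d f x y : c < x -> y < d ->
  {in `]c, d[, continuous f} -> {within `[x, y], continuous f}.
Proof.
move=> cx yd cf; apply: continuous_in_subspaceT => z /[!inE]/= zxy.
by apply: cf; move: zxy; rewrite !in_itv/= => /andP[xz zy]; lra.
Qed.

Lemma is_derive_LRcontinuous c d f F x y : c < x -> x < y -> y < d ->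
  (forall z, z \in `]c, d[ -> is_derive z 1 F (f z)) ->
  derivable_oo_LRcontinuous F x y.
Proof.
move=> cx xy yd dF.
have cF z : z \in `]c, d[ -> F @ z --> F z.
  move=> /dF dFz; apply: differentiable_continuous.
  by apply/derivable1_diffP; exact: ex_derive.
split.
- move=> z zxy; have zcd : z \in `]c, d[.
    by move: zxy; rewrite !in_itv/= => /andP[? ?]; lra.
  have := dF z zcd => dFz; exact: ex_derive.
- by apply: cvg_at_right_filter; apply: cF; rewrite in_itv/=; lra.
- by apply: cvg_at_left_filter; apply: cF; rewrite in_itv/=; lra.
Qed.

(** On the inner intervals the closed fundamental theorem gives increments of [F], which tend to
    [m - l], while monotone convergence gives the integral over []c, d[]. The equality also shows
    that this integral is finite. *)
Lemma ge0_FTC2_oo c d f F (l m : R) : c < d ->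
  {in `]c, d[, continuous f} -> (forall x, x \in `]c, d[ -> 0 <= f x) ->
  (forall x, x \in `]c, d[ -> is_derive x 1 F (f x)) ->
  F x @[x --> c^'+] --> l -> F x @[x --> d^'-] --> m ->
  (\int[mu]_(x in `]c, d[) (f x)%:E = (m - l)%:E)%E.
Proof.
move=> cd cf f0 dF Fl Fm.
apply: (cvg_unique _ (inner_exhaust_cvg cd cf f0)) => //.
have -> : (fun n => \int[mu]_(x in `[inner_left c d n, inner_right c d n])
    (f x)%:E)%E = (fun n => (F (inner_right c d n) - F (inner_left c d n))%:E).
  apply/funext => n; have [h1 h2 h3] := inner_lt n cd.
  rewrite (continuous_FTC2 (F := F))//.
  - exact: oo_continuous_within h1 h3 cf.
  - exact: is_derive_LRcontinuous h1 h2 h3 dF.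
  - move=> x xcd; rewrite derive1E; have xcd' : x \in `]c, d[.
      by move: xcd; rewrite !in_itv/= => /andP[? ?]; lra.
    by have := dF x xcd' => dFx; rewrite derive_val.
apply: cvg_EFin; first by near=> n.
apply: cvgB; first exact: cvg_comp_inner_right.
exact: cvg_comp_inner_left.
Unshelve. all: by end_near. Qed.

(** [F] carries the inner intervals of []c, d[] to closed intervals exhausting []c', d'[]. Ordinary
    substitution holds on each of them, and both sides are limits. *)
Lemma ge0_substitution_oo c d c' d' F f G : c < d ->
  {in `]c, d[ &, {homo F : x y / x < y}} ->
  {in `]c, d[, continuous f} ->
  (forall x, x \in `]c, d[ -> is_derive x 1 F (f x)) ->
  F x @[x --> c^'+] --> c' -> F x @[x --> d^'-] --> d' ->
  (forall x, x \in `]c, d[ -> F x \in `]c', d'[) ->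
  (forall x, x \in `]c, d[ -> 0 <= f x) ->
  {in `]c', d'[, continuous G} -> (forall x, x \in `]c', d'[ -> 0 <= G x) ->
  (\int[mu]_(x in `]c', d'[) (G x)%:E =
   \int[mu]_(x in `]c, d[) (G (F x) * f x)%:E)%E.
Proof.
move=> cd iF cf dF Fc Fd Fcd f0 cG G0.
have cF z : z \in `]c, d[ -> F @ z --> F z.
  move=> /dF dFz; apply: differentiable_continuous.
  by apply/derivable1_diffP; exact: ex_derive.
have cGF : {in `]c, d[, continuous (fun x => G (F x) * f x)}.
  move=> x xcd; apply: cvgM; last exact: cf.
  by apply: continuous_comp; [exact: cF|apply: cG; exact: Fcd].
have GF0 x : x \in `]c, d[ -> 0 <= G (F x) * f x.
  by move=> xcd; rewrite mulr_ge0 ?f0// G0// Fcd.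
apply: esym; apply: (cvg_unique _ (inner_exhaust_cvg cd cGF GF0)) => //.
have inL n : inner_left c d n \in `]c, d[.
  by have [? ? ?] := inner_lt n cd; rewrite in_itv/=; lra.
have inR n : inner_right c d n \in `]c, d[.
  by have [? ? ?] := inner_lt n cd; rewrite in_itv/=; lra.
have iFle : {in `]c, d[ &, {homo F : x y / x <= y}}.
  move=> x y xcd ycd; rewrite le_eqVlt => /predU1P[->//|xy].
  by apply/ltW/iF.
have -> : (fun n => \int[mu]_(x in `[inner_left c d n, inner_right c d n])
    (G (F x) * f x)%:E)%E = (fun n => \int[mu]_(x in `[F (inner_left c d n),
    F (inner_right c d n)]) (G x)%:E)%E.
  apply/funext => n; have [h1 h2 h3] := inner_lt n cd.
  have F'E x : x \in `]c, d[ -> F^`()%classic x = f x.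
    by move=> /dF dFx; rewrite derive1E derive_val.
  have sub x : x \in `[inner_left c d n, inner_right c d n] -> x \in `]c, d[.
    exact: inner_sub.
  have cF' x : x \in `]c, d[ -> F^`()%classic @ x --> f x.
    move=> xcd; apply: cvg_trans (cf x xcd); apply: near_eq_cvg.
    near=> z; apply: esym; apply: F'E; near: z.
    by apply: near_in_itvoo.
  rewrite integration_by_substitution_increasing//.
  - apply: eq_integral => x /[!inE]/= xcd; congr EFin => /=.
    by rewrite -(F'E x) ?(sub x).
  - exact: ltW.
  - by move=> x y /sub xcd /sub ycd; exact: iF.
  - move=> x xcd; have xcd' : x \in `]c, d[.
      by move: xcd; rewrite !in_itv/= => /andP[? ?]; lra.
    by rewrite /continuous_at F'E//; exact: cF'.
  - apply/cvg_ex; exists (f (inner_left c d n)).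
    by apply: cvg_at_right_filter; exact: cF'.
  - apply/cvg_ex; exists (f (inner_right c d n)).
    by apply: cvg_at_left_filter; exact: cF'.
  - exact: is_derive_LRcontinuous h1 h2 h3 dF.
  - apply: oo_continuous_within cG.
    + by have := Fcd _ (inL n); rewrite in_itv/= => /andP[].
    + by have := Fcd _ (inR n); rewrite in_itv/= => /andP[].
(* The endpoints are the images under [F] of the inner ones, which is why the exhaustion is stated
   for arbitrary monotone sequences. *)
apply: ge0_exhaust_cvg => //.
- by move=> n m nm; apply: iFle => //; rewrite lerD2l inner_step_le.
- by move=> n m nm; apply: iFle => //; rewrite lerD2l lerN2 inner_step_le.
- by move=> n; have := Fcd _ (inL n); rewrite in_itv/= => /andP[].
- by move=> n; have := Fcd _ (inR n); rewrite in_itv/= => /andP[].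
- exact: cvg_comp_inner_left.
- exact: cvg_comp_inner_right.
Unshelve. all: by end_near. Qed.

(** The map is decreasing, so [ge0_substitution_oo] does not cover it. It exchanges the inner
    endpoints of the two intervals exactly, so the approximating integrals agree term by term. *)
Lemma ge0_reflection_oo c d (s : R) G : c < d ->
  {in `]s - d, s - c[, continuous G} ->
  (forall x, x \in `]s - d, s - c[ -> 0 <= G x) ->
  (\int[mu]_(x in `](s - d)%R, (s - c)%R[) (G x)%:E =
   \int[mu]_(x in `]c, d[) (G (s - x)%R)%:E)%E.
Proof.
move=> cd cG G0.
have sub (x : R) : x \in `]c, d[ -> s - x \in `]s - d, s - c[.
  by rewrite !in_itv/= => /andP[? ?]; lra.
have dB (x : R) : is_derive x (1 : R) (fun y : R => s - y : R) (- 1 : R).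
  by apply: is_derive_eq; rewrite add0r mul1r.
have cGF : {in `]c, d[, continuous (fun x => G (s - x))}.
  move=> x xcd; apply: continuous_comp; last by apply: cG; exact: sub.
  by apply: cvgB; [exact: cvg_cst|exact: cvg_id].
have GF0 x : x \in `]c, d[ -> 0 <= G (s - x) by move=> /sub /G0.
apply: esym; apply: (cvg_unique _ (inner_exhaust_cvg cd cGF GF0)) => //.
have sdc : s - d < s - c by lra.
apply: cvg_trans (inner_exhaust_cvg sdc cG G0); apply: near_eq_cvg.
near=> n; have [h1 h2 h3] := inner_lt n cd.
have e : s - c - (s - d) = d - c by lra.
have -> : inner_left (s - d) (s - c) n = s - inner_right c d n.
  by rewrite /inner_left /inner_right e; set z := (_ / _); lra.
have -> : inner_right (s - d) (s - c) n = s - inner_left c d n.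
  by rewrite /inner_left /inner_right e; set z := (_ / _); lra.
have D1 : (fun y : R => s - y)^`()%classic = cst (- 1).
  by apply/funext => x; rewrite derive1E derive_val.
rewrite (@integration_by_substitution_decreasing _ (fun y => s - y))//.
- apply: eq_integral => x _; congr EFin => /=.
  by rewrite fctE/= D1 /= opprK mulr1.
- exact: ltW.
- by move=> x y _ _ xy; lra.
- by move=> x _; rewrite D1; exact: cst_continuous.
- by rewrite D1; exact: is_cvg_cst.
- by rewrite D1; exact: is_cvg_cst.
- by apply: is_derive_LRcontinuous h1 h2 h3 _ => z _; exact: dB.
- by apply: oo_continuous_within cG; lra.
Unshelve. all: by end_near. Qed.

End Improper.

(** * Beta weights *)

Section BetaWeight.
Context {R : realType}.
Implicit Types (f g F G : R -> R) (a b c d x y r s : R).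
Local Notation mu := lebesgue_measure.

(** Products of powers of positive numbers become single exponentials, so that identities between
    them reduce to linear identities in the exponents, which [ring] decides. *)
Lemma powR_expR x r : 0 < x -> x `^ r = expR (r * ln x).
Proof. by move=> x0; rewrite /powR gt_eqF. Qed.

Lemma is_derive_powR_comp g (dg : R) x r : 0 < g x -> is_derive x 1 g dg ->
  is_derive x 1 (fun y => g y `^ r) (r * g x `^ (r - 1) * dg).
Proof.
move=> gx0 dgx.
have H := is_derive1_powR r gx0.
have := @is_derive1_comp _ (fun y => y `^ r) g x _ _ H dgx.
by rewrite /comp.
Qed.

Lemma cvg_powR_comp {T : Type} {A : set_system T} {FA : Filter A}
    (g : T -> R) (l : R) r : 0 < l ->
  g x @[x --> A] --> l -> (g x) `^ r @[x --> A] --> l `^ r.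
Proof.
move=> l0 gl; apply: (@cvg_comp _ _ _ g (fun y : R => y `^ r)); first exact: gl.
have D : derivable (fun y : R => y `^ r) l 1.
  exact: (@ex_derive _ _ _ _ _ _ _ (is_derive1_powR r l0)).
by move/derivable1_diffP : D => /differentiable_continuous.
Qed.

Lemma cvg_subr_powR_right a r : 0 < r -> (x - a) `^ r @[x --> a^'+] --> (0 : R).
Proof.
move=> r0.
apply: (@increasing_cvg_at_right_comp _ (fun x => x - a) (fun y => y `^ r)
  a (BRight (a + 1))).
- by rewrite bnd_simp ltrDl.
- by move=> x y _ _; rewrite ltrD2r.
- by apply: cvg_at_right_filter; apply: cvgB; [exact: cvg_id|exact: cvg_cst].
- by rewrite subrr; exact: powR_cvg0.
Qed.

(** The power is monotone, in a direction given by the sign of [r]; the sum of both end values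
    covers either case. *)
Lemma powR_le_ends c d x r : 0 < c -> c <= x <= d -> x `^ r <= c `^ r + d `^ r.
Proof.
move=> c0 /andP[cx xd]; have x0 : 0 < x by lra.
have d0 : 0 < d by lra.
rewrite !powR_expR//.
have [r0|r0] := leP 0 r.
  rewrite (@le_trans _ _ (expR (r * ln d)))// ?lerDr ?expR_ge0//.
  by rewrite ler_expR ler_wpM2l// ler_ln.
rewrite (@le_trans _ _ (expR (r * ln c)))// ?lerDl ?expR_ge0//.
by rewrite ler_expR ler_wnM2l//; [exact: ltW|rewrite ler_ln].
Qed.

(** The weight [w(r, s)]; over []0, 1[] its integral is Euler's Beta function. *)
Definition beta_weight a b r s x : R := (x - a) `^ (r - 1) * (b - x) `^ (s - 1).

Lemma beta_weight_ge0 a b r s x : 0 <= beta_weight a b r s x.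
Proof. by rewrite mulr_ge0// powR_ge0. Qed.

Lemma beta_weight_reflect a b r s x :
  beta_weight a b r s (a + b - x) = beta_weight a b s r x.
Proof.
rewrite /beta_weight mulrC; congr (_ `^ _ * _ `^ _); lra.
Qed.

Lemma beta_weight_continuous a b r s :
  {in `]a, b[, continuous (beta_weight a b r s)}.
Proof.
move=> x; rewrite in_itv/= => /andP[ax xb]; apply: cvgM.
- apply: cvg_powR_comp; first by rewrite subr_gt0.
  by apply: cvgB; [exact: cvg_id|exact: cvg_cst].
- apply: cvg_powR_comp; first by rewrite subr_gt0.
  by apply: cvgB; [exact: cvg_cst|exact: cvg_id].
Qed.

Lemma measurable_powR_subl a r : measurable_fun setT (fun x => (x - a) `^ r).
Proof.
apply: (@measurableT_comp _ _ _ _ _ _ (fun y => y `^ r)).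
  exact: measurable_powR.
exact: measurable_funB.
Qed.

Lemma measurable_powR_subr a r : measurable_fun setT (fun x => (a - x) `^ r).
Proof.
apply: (@measurableT_comp _ _ _ _ _ _ (fun y => y `^ r)).
  exact: measurable_powR.
exact: measurable_funB.
Qed.

Lemma measurable_beta_weight a b r s :
  measurable_fun setT (beta_weight a b r s).
Proof.
by apply: measurable_funM;
  [exact: measurable_powR_subl|exact: measurable_powR_subr].
Qed.

Lemma integral_powR_subl c d r : c < d -> 0 < r ->
  (\int[mu]_(x in `]c, d[) ((x - c) `^ (r - 1))%:E = ((d - c) `^ r / r)%:E)%E.
Proof.
move=> cd r0.
rewrite -[in RHS](subr0 ((d - c) `^ r / r)).
apply: (@ge0_FTC2_oo _ c d _ (fun x => (x - c) `^ r / r)) => //.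
- move=> x; rewrite in_itv/= => /andP[cx xd].
  apply: cvg_powR_comp; first by rewrite subr_gt0.
  by apply: cvgB; [exact: cvg_id|exact: cvg_cst].
- by move=> x _; rewrite powR_ge0.
- move=> x; rewrite in_itv/= => /andP[cx xd].
  have xc : 0 < x - c by rewrite subr_gt0.
  have dB : is_derive x (1 : R) (fun y : R => y - c : R) (1 : R).
    by apply: is_derive_eq; rewrite ?subr0 ?oppr0 ?addr0.
  have H := @is_derive_powR_comp (fun y => y - c) 1 x r xc dB.
  apply: is_derive_eq.
  by rewrite scaler0 add0r mulr1 /GRing.scale/= mulrA mulVf ?gt_eqF// mul1r.
- rewrite -[X in _ --> X](mul0r r^-1); apply: cvgM; last exact: cvg_cst.
  exact: cvg_subr_powR_right.
- apply: cvg_at_left_filter; apply: cvgM; last exact: cvg_cst.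
  apply: cvg_powR_comp; first by rewrite subr_gt0.
  by apply: cvgB; [exact: cvg_id|exact: cvg_cst].
Qed.

Lemma integrable_powR_subl c d r : c < d -> 0 < r ->
  mu.-integrable `]c, d[ (EFin \o (fun x => (x - c) `^ (r - 1))).
Proof.
move=> cd r0; apply/integrableP; split.
  by apply/measurable_EFinP/measurable_funTS; exact: measurable_powR_subl.
under eq_integral do rewrite /= ger0_norm ?powR_ge0//.
by rewrite integral_powR_subl// ltry.
Qed.

Lemma integrable_powR_subr c d r : c < d -> 0 < r ->
  mu.-integrable `]c, d[ (EFin \o (fun x => (d - x) `^ (r - 1))).
Proof.
move=> cd r0; apply/integrableP; split.
  by apply/measurable_EFinP/measurable_funTS; exact: measurable_powR_subr.
under eq_integral do rewrite /= ger0_norm ?powR_ge0//.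
have := @ge0_reflection_oo _ c d (c + d) (fun x => (x - c) `^ (r - 1)) cd.
have -> : c + d - d = c by lra.
have -> : c + d - c = d by lra.
rewrite integral_powR_subl// => H.
under eq_integral => x _.
  rewrite (_ : d - x = c + d - x - c); last by lra.
  over.
rewrite -H ?ltry//.
- move=> x; rewrite in_itv/= => /andP[cx xd].
  apply: cvg_powR_comp; first by rewrite subr_gt0.
  by apply: cvgB; [exact: cvg_id|exact: cvg_cst].
- by move=> x _; rewrite powR_ge0.
Qed.

(** On each half of the interval the factor of the far endpoint is bounded, by [M s] or [M r], and
    the factor of the near endpoint is an integrable power. The sum of the two resulting bounds
    dominates everywhere. *)
Lemma integrable_beta_weight a b r s : a < b -> 0 < r -> 0 < s ->
  mu.-integrable `]a, b[ (EFin \o beta_weight a b r s).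
Proof.
move=> ab r0 s0; pose h := (b - a) / 2.
have h0 : 0 < h by rewrite divr_gt0// subr_gt0.
pose M (e : R) := h `^ (e - 1) + (b - a) `^ (e - 1).
have M0 e : 0 <= M e by rewrite addr_ge0// powR_ge0.
have I : mu.-integrable `]a, b[ (
    (fun x => (M s)%:E * ((x - a)%R `^ (r - 1)%R)%:E)
    \+ (fun x => (M r)%:E * ((b - x)%R `^ (s - 1)%R)%:E))%E.
  apply: integrableD => //; apply: integrableZl => //.
    exact: integrable_powR_subl.
  exact: integrable_powR_subr.
apply: le_integrable I => //.
  by apply/measurable_EFinP/measurable_funTS; exact: measurable_beta_weight.
move=> x /=; rewrite in_itv/= => /andP[ax xb].
rewrite !lee_fin ger0_norm ?beta_weight_ge0// ger0_norm; last first.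
  by rewrite addr_ge0// mulr_ge0// powR_ge0.
have [xh|xh] := leP x (a + h).
  rewrite (@le_trans _ _ (M s * (x - a) `^ (r - 1)))//.
    rewrite /beta_weight mulrC ler_wpM2r ?powR_ge0// powR_le_ends//.
    by move: xh; rewrite /h => xh; lra.
  by rewrite lerDl mulr_ge0// powR_ge0.
rewrite (@le_trans _ _ (M r * (b - x) `^ (s - 1)))//.
  rewrite /beta_weight ler_wpM2r ?powR_ge0// powR_le_ends//.
  by move: xh; rewrite /h => xh; lra.
by rewrite lerDr mulr_ge0// powR_ge0.
Qed.

End BetaWeight.

(** * Abel's integral of a beta weight *)

Section Abel.
Context {R : realType}.
Implicit Types (a b m p q x y z s t : R).
Local Notation mu := lebesgue_measure.

(** The integrand of [abel_affine] at [y = a + X s], with [X = x - a], [t = 1 - s] and [B = b - y].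
    The powers of [X] add up to [p - m = 1 - q]. *)
Lemma powR_affine_subst m p q (X s t B : R) : p + q = 1 + m ->
  0 < X -> 0 < s -> 0 < t -> 0 < B ->
  (X * t) `^ (- m) * ((X * s) `^ (p - 1) * B `^ (q - 1)) * X =
  s `^ (p - 1) * t `^ (1 - m - 1) * (X `^ (1 - q) * B `^ (q - 1)).
Proof.
move=> pq X0 s0 t0 B0.
have -> : q = 1 + m - p by lra.
rewrite -[X in _ * X = _](powRr1 (ltW X0)).
rewrite !powR_expR ?mulr_gt0// !lnM ?posrE// -!expRD; congr expR; ring.
Qed.

(** For [D = l - v s] the bases are [tau] and [1 - tau] with [tau = s (l - v) / D], and the last
    factor on the left is the derivative of [tau]. The powers of [D] add up to
    [m - p - 1 = q - 2]. *)
Lemma powR_moebius_subst m p q (l v s D : R) : p + q = 1 + m ->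
  0 < l -> 0 < l - v -> 0 < s -> 0 < 1 - s -> 0 < D ->
  (s * (l - v) / D) `^ (p - 1) * (l * (1 - s) / D) `^ (1 - m - 1) *
    ((l - v) * l / D ^+ 2) =
  l `^ (1 - m) * (l - v) `^ p *
    (s `^ (p - 1) * (1 - s) `^ (1 - m - 1) * D `^ (q - 2)).
Proof.
move=> pq l0 w0 s0 s1 D0.
have -> : q = 1 + m - p by lra.
move: (l - v) w0 => w w0; move: (1 - s) s1 => t t0.
have -> : w * l / D ^+ 2 = w `^ 1 * l `^ 1 * (D^-1 `^ 1 * D^-1 `^ 1).
  by rewrite !powRr1 ?invr_ge0 ?ltW// -exprVn expr2.
rewrite !powR_expR ?mulr_gt0 ?invr_gt0//.
rewrite !lnM ?posrE ?mulr_gt0 ?invr_gt0// !lnV ?posrE//.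
by rewrite -!expRD; congr expR; ring.
Qed.

(** The left side is the product rule for [v^(1-q) (l - v s)^(q-1)] as a function of [v]. After the
    common factor is taken out, [v s + D = l] remains, so the derivative is again a pure product of
    powers. *)
Lemma powR_kernel_derive q (v s D l : R) : 0 < v -> 0 < D -> D = l - v * s ->
  v `^ (1 - q) *: ((q - 1) * D `^ (q - 1 - 1) * - s) +
    D `^ (q - 1) *: ((1 - q) * v `^ (1 - q - 1) * 1) =
  (1 - q) * l * (v `^ (- q) * D `^ (q - 2)).
Proof.
move=> v0 D0 DE; rewrite /GRing.scale/=.
have -> : v `^ (1 - q) = v * v `^ (- q).
  rewrite -{2}(powRr1 (ltW v0)) -powRD; first by congr (_ `^ _); lra.
  by rewrite (gt_eqF v0) implybT.
have -> : D `^ (q - 1) = D * D `^ (q - 2).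
  rewrite -{2}(powRr1 (ltW D0)) -powRD; first by congr (_ `^ _); lra.
  by rewrite (gt_eqF D0) implybT.
have -> : q - 1 - 1 = q - 2 by lra.
have -> : 1 - q - 1 = - q by lra.
by rewrite DE; ring.
Qed.

Lemma cvg_sublM (a k : R) {A : set_system R} {FA : Filter A} (l : R) :
  x @[x --> A] --> l -> (x - a) * k @[x --> A] --> (l - a) * k.
Proof.
move=> Al; apply: cvgM; last exact: cvg_cst.
by apply: cvgB; [exact: Al|exact: cvg_cst].
Qed.

(* Substitute [y = a + (x - a) s]. *)
Lemma abel_affine a b m p q x : p + q = 1 + m -> a < x < b ->
  (\int[mu]_(y in `]a, x[) ((x - y)%R `^ (- m) * beta_weight a b p q y)%:E =
   \int[mu]_(s in `]0%R, 1%R[) (beta_weight 0 1 p (1 - m) s *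
     ((x - a) `^ (1 - q) * (b - a - (x - a) * s) `^ (q - 1)))%R%:E)%E.
Proof.
move=> pq /andP[ax xb]; have X0 : 0 < x - a by rewrite subr_gt0.
have Fin s : s \in `]0, 1[ -> a + (x - a) * s \in `]a, x[.
  by rewrite !in_itv/= => /andP[s0 s1]; nra.
have cF : continuous (fun s => a + (x - a) * s).
  move=> s; apply: cvgD; first exact: cvg_cst.
  by apply: cvgM; [exact: cvg_cst|exact: cvg_id].
etransitivity.
  apply: (@ge0_substitution_oo _ 0 1 a x (fun s => a + (x - a) * s)
    (cst (x - a))) => //.
  - by move=> s t _ _ st; rewrite ltrD2l ltr_pM2l.
  - by move=> s _; exact: cst_continuous.
  - move=> s _.
    by apply: is_derive_eq; rewrite /GRing.scale/=; ring.
  - have := cF 0; rewrite /continuous_at/= mulr0 addr0.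
    exact: cvg_at_right_filter.
  - have := cF 1; rewrite /continuous_at/= mulr1 subrKC.
    exact: cvg_at_left_filter.
  - by move=> s _; exact: ltW.
  - move=> y; rewrite in_itv/= => /andP[ay yx]; apply: cvgM.
      apply: cvg_powR_comp; first by rewrite subr_gt0.
      by apply: cvgB; [exact: cvg_cst|exact: cvg_id].
    by apply: beta_weight_continuous; rewrite in_itv/= ay (lt_trans yx).
  - by move=> y _; rewrite mulr_ge0 ?powR_ge0 ?beta_weight_ge0.
apply: eq_integral => s; rewrite inE/= in_itv/= => /andP[s0 s1].
congr EFin; rewrite /beta_weight subr0 -(@powR_affine_subst m p q)//.
+ by congr (_ `^ _ * (_ `^ _ * _ `^ _) * _); ring.
+ by rewrite subr_gt0.
+ by nra.
Qed.

(** The factor of [abel_affine] that depends on [x] is the integral of its own derivative, computed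
    in [powR_kernel_derive] with [l = b - a] and [v = z - a]. The boundary term at [a] vanishes
    because [1 - q > 0]. *)
Lemma abel_kernel_primitive a b q x s : q < 1 -> a < x < b -> 0 < s < 1 ->
  (\int[mu]_(z in `]a, x[) ((1 - q) * (b - a) *
     ((z - a) `^ (- q) * (b - a - (z - a) * s) `^ (q - 2)))%R%:E =
   ((x - a) `^ (1 - q) * (b - a - (x - a) * s) `^ (q - 1))%R%:E)%E.
Proof.
move=> q1 /andP[ax xb] /andP[s0 s1].
have D0 z : a <= z <= x -> 0 < b - a - (z - a) * s by move=> /andP[? ?]; nra.
have cz z : a < z <= x ->
  (fun z => (z - a) `^ (1 - q) * (b - a - (z - a) * s) `^ (q - 1)) @ z -->
  (z - a) `^ (1 - q) * (b - a - (z - a) * s) `^ (q - 1).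
  move=> /andP[az zx]; apply: cvgM; apply: cvg_powR_comp.
  - by rewrite subr_gt0.
  - by apply: cvgB; [exact: cvg_id|exact: cvg_cst].
  - by apply: D0; rewrite ltW.
  - by apply: cvgB; [exact: cvg_cst|apply: cvg_sublM; exact: cvg_id].
rewrite -[in RHS](subr0 (_ * _ `^ (q - 1))).
apply: (@ge0_FTC2_oo _ a x _ (fun z => (z - a) `^ (1 - q) *
  (b - a - (z - a) * s) `^ (q - 1))) => //.
- move=> z; rewrite in_itv/= => /andP[az zx].
  apply: cvgM; first exact: cvg_cst.
  apply: cvgM; apply: cvg_powR_comp.
  - by rewrite subr_gt0.
  - by apply: cvgB; [exact: cvg_id|exact: cvg_cst].
  - by apply: D0; rewrite !ltW.
  - by apply: cvgB; [exact: cvg_cst|apply: cvg_sublM; exact: cvg_id].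
- move=> z _; rewrite !mulr_ge0 ?powR_ge0 ?subr_ge0 ?ltW//.
  by rewrite (lt_trans ax).
- move=> z; rewrite in_itv/= => /andP[az zx].
  have za : 0 < z - a by rewrite subr_gt0.
  have Dz : 0 < b - a - (z - a) * s by apply: D0; rewrite !ltW.
  rewrite -(powR_kernel_derive q za Dz (erefl _)).
  apply: is_deriveM.
    apply: (@is_derive_powR_comp _ (fun z => z - a)) => //.
    by apply: is_derive_eq; rewrite /GRing.scale/=; ring.
  apply: (@is_derive_powR_comp _ (fun z => b - a - (z - a) * s)) => //.
  by apply: is_derive_eq; rewrite /GRing.scale/=; ring.
- rewrite -[X in _ --> X](mul0r ((b - a - (a - a) * s) `^ (q - 1))).
  apply: cvgM; first by apply: cvg_subr_powR_right; rewrite subr_gt0.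
  apply: cvg_powR_comp; first by apply: D0; rewrite lexx ltW.
  apply: cvgB; first exact: cvg_cst.
  by apply: cvg_sublM; apply: cvg_at_right_filter; exact: cvg_id.
- by apply: cvg_at_left_filter; apply: cz; rewrite ax lexx.
Qed.

(* Substitute [tau = s (l - v) / (l - v s)], which fixes 0 and 1. *)
Lemma moebius_integral m p q (l v : R) : p + q = 1 + m -> 0 < v < l ->
  (\int[mu]_(s in `]0%R, 1%R[) (l `^ (1 - m) * (l - v) `^ p *
     (beta_weight 0 1 p (1 - m) s * (l - v * s) `^ (q - 2)))%R%:E =
   \int[mu]_(s in `]0%R, 1%R[) (beta_weight 0 1 p (1 - m) s)%:E)%E.
Proof.
move=> pq /andP[v0 vl]; have l0 : 0 < l by lra.
have w0 : 0 < l - v by lra.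
have D0 s : 0 <= s <= 1 -> 0 < l - v * s by move=> /andP[? ?]; nra.
have cF s : 0 <= s <= 1 -> (fun s => s * (l - v) / (l - v * s)) @ s -->
    s * (l - v) / (l - v * s).
  move=> s01; apply: cvgM.
    by apply: cvgM; [exact: cvg_id|exact: cvg_cst].
  apply: cvgV; first by rewrite gt_eqF// D0.
  apply: cvgB; first exact: cvg_cst.
  by apply: cvgM; [exact: cvg_cst|exact: cvg_id].
have FB s : 0 <= s <= 1 ->
    1 - s * (l - v) / (l - v * s) = l * (1 - s) / (l - v * s).
  move=> s01; have := D0 s s01 => Ds; field; exact: lt0r_neq0.
apply: esym.
etransitivity.
  apply: (@ge0_substitution_oo _ 0 1 0 1 (fun s => s * (l - v) / (l - v * s))
    (fun s => (l - v) * l / (l - v * s) ^+ 2)) => //.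
  - move=> s t; rewrite !in_itv/= => /andP[s0 s1] /andP[t0 t1] st.
    have Ds : 0 < l - v * s by apply: D0; rewrite !ltW.
    have Dt : 0 < l - v * t by apply: D0; rewrite !ltW.
    rewrite ltr_pdivrMr// mulrAC ltr_pdivlMr//.
    have := mulr_gt0 w0 l0 => wl; nra.
  - move=> s; rewrite in_itv/= => /andP[s0 s1].
    apply: cvgM; first exact: cvg_cst.
    have Ds : 0 < l - v * s by apply: D0; rewrite !ltW.
    apply: cvgV; first by rewrite expf_neq0// gt_eqF.
    under eq_fun do rewrite expr2.
    rewrite expr2; apply: cvgM; (apply: cvgB; first exact: cvg_cst);
      by apply: cvgM; [exact: cvg_cst|exact: cvg_id].
  - move=> s; rewrite in_itv/= => /andP[s0 s1].
    have Ds : 0 < l - v * s by apply: D0; rewrite !ltW.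
    have d1 : is_derive s (1 : R) (fun s => s * (l - v) : R) (l - v).
      by apply: is_derive_eq; rewrite /GRing.scale/=; ring.
    have d2 : is_derive s (1 : R) (fun s => l - v * s : R) (- v).
      by apply: is_derive_eq; rewrite /GRing.scale/=; ring.
    have d3 := @is_deriveV _ (fun s => l - v * s) s _ 1 (lt0r_neq0 Ds) d2.
    apply: (is_derive_eq (is_deriveM d1 d3)).
    rewrite /GRing.scale/=; field; exact: lt0r_neq0.
  - have := cF 0; rewrite mul0r mul0r lexx ler01 => /(_ isT).
    exact: cvg_at_right_filter.
  - have := cF 1; rewrite mul1r mulr1 divff ?gt_eqF// lexx ler01 => /(_ isT).
    exact: cvg_at_left_filter.
  - move=> s; rewrite in_itv/= => /andP[s0 s1].
    have Ds : 0 < l - v * s by apply: D0; rewrite !ltW.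
    rewrite in_itv/= divr_gt0 ?mulr_gt0//= ltr_pdivrMr// mul1r; nra.
  - move=> s _; apply: divr_ge0; last exact: sqr_ge0.
    by apply: mulr_ge0; exact: ltW.
  - exact: beta_weight_continuous.
  - by move=> s _; exact: beta_weight_ge0.
apply: eq_integral => s; rewrite inE/= in_itv/= => /andP[s0 s1].
congr EFin; rewrite /beta_weight !subr0 FB ?ltW//.
apply: powR_moebius_subst => //; first by rewrite subr_gt0.
by apply: D0; rewrite !ltW.
Qed.

End Abel.

(** * Exchange of integrals over a rectangle *)

Section Tonelli.
Context {R : realType}.
Local Notation mu := lebesgue_measure.

(** Tonelli's theorem in the plane, applied to the extension of [k] by zero outside [D1] times
    [D2]. *)
Lemma ge0_tonelli_setX (D1 D2 : set R) (k : R -> R -> R) :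
  measurable D1 -> measurable D2 ->
  measurable_fun setT (fun z : R * R => k z.1 z.2) ->
  (forall x y, 0 <= k x y) ->
  (\int[mu]_(x in D1) \int[mu]_(y in D2) (k x y)%:E =
   \int[mu]_(y in D2) \int[mu]_(x in D1) (k x y)%:E)%E.
Proof.
move=> mD1 mD2 mk k0.
pose f : R * R -> \bar R := (fun z => (k z.1 z.2)%:E) \_ (D1 `*` D2).
have f0 z : (0 <= f z)%E.
  by rewrite /f patchE; case: ifPn => // _; rewrite lee_fin.
have mf : measurable_fun setT f.
  apply/(measurable_restrictT _ _).1; first exact: measurableX.
  by apply: measurable_funTS; apply/measurable_EFinP.
have T := @fubini_tonelli _ _ (measurableTypeR R) (measurableTypeR R) R
  mu mu f mf f0.
rewrite integral_mkcond [RHS]integral_mkcond.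
transitivity (\int[mu]_x \int[mu]_y f (x, y))%E.
  apply: eq_integral => x _; rewrite patchE; case: ifPn => xD.
    rewrite integral_mkcond; apply: eq_integral => y _.
    rewrite /f !patchE in_setX/= xD/=; by case: ifPn.
  rewrite integral0_eq// => y _; rewrite /f patchE in_setX/= (negbTE xD).
  by [].
rewrite T; apply: eq_integral => y _; rewrite patchE; case: ifPn => yD.
  rewrite [RHS]integral_mkcond; apply: eq_integral => x _.
  by rewrite /f !patchE in_setX/= yD andbT; case: ifPn.
by rewrite integral0_eq// => x _; rewrite /f patchE in_setX/= (negbTE yD) andbF.
Qed.

End Tonelli.

(** * The Abel integral as a primitive of the dual weight *)

Section AbelIdentity.
Context {R : realType}.
Implicit Types (a b m p q x y z s t : R).
Local Notation mu := lebesgue_measure.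

Lemma measurable_abel_kernel a b m p q (k : R) :
  measurable_fun setT (fun z : R * R => beta_weight 0 1 p (1 - m) z.2 *
    (k * ((z.1 - a) `^ (- q) * (b - a - (z.1 - a) * z.2) `^ (q - 2)))).
Proof.
have mp (e : R) : measurable_fun setT (fun y : R => y `^ e).
  exact: measurable_powR.
apply: measurable_funM.
  apply: (measurableT_comp (f := beta_weight 0 1 p (1 - m))) => //.
  exact: measurable_beta_weight.
apply: measurable_funM => //; apply: measurable_funM.
  apply: (measurableT_comp (f := fun y : R => y `^ (- q))) => //.
  exact: measurable_funB.
apply: (measurableT_comp (f := fun y : R => y `^ (q - 2))) => //.
by apply: measurable_funB => //; apply: measurable_funM => //;
  exact: measurable_funB.
Qed.

(** This is the integrated form of the derivative formula for the fractional integral of [w(p, q)].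
    Exchanging two integrals of nonnegative functions takes the place of differentiating a singular
    integral. *)
Lemma abel_beta_weight a b m p q : a < b -> 0 < p -> m < 1 -> q < 1 ->
  p + q = 1 + m ->
  exists C : R, forall x, a < x < b ->
    (\int[mu]_(y in `]a, x[) ((x - y)%R `^ (- m) * beta_weight a b p q y)%:E =
     C%:E * \int[mu]_(y in `]a, x[)
       (beta_weight a b (1 - q)%R (1 - p)%R y)%:E)%E.
Proof.
move=> ab p0 m1 q1 pq; have l0 : 0 < b - a by rewrite subr_gt0.
have m10 : 0 < 1 - m by rewrite subr_gt0.
have B0 : (\int[mu]_(s in `]0%R, 1%R[) (beta_weight 0 1 p (1 - m) s)%:E)%E
    \is a fin_num.
  by apply: integrable_fin_num => //; exact: integrable_beta_weight.
pose B : R := fine (\int[mu]_(s in `]0%R, 1%R[)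
  (beta_weight 0 1 p (1 - m) s)%:E)%E.
(* With [l = b - a], the Moebius integral evaluates the integral over [s] as [B] divided by
   [l^(1-m) (b - z)^p]. The kernel contributes [(1 - q) l], so the power of [l] left over is
   [l^m]. *)
exists ((1 - q) * (b - a) `^ m * B) => x axb; have /andP[ax xb] := axb.
rewrite (abel_affine pq axb).
pose k (z s : R) := beta_weight 0 1 p (1 - m) s * ((1 - q) * (b - a) *
  ((z - a) `^ (- q) * (b - a - (z - a) * s) `^ (q - 2))).
have k0 z s : 0 <= k z s.
  by rewrite /k !mulr_ge0 ?beta_weight_ge0 ?powR_ge0// ?subr_ge0// ltW.
(* The factor depending on [x] is written as an integral over [z < x];
   exchanging the integrals leaves a Moebius integral for each [z]. *)
transitivity (\int[mu]_(s in `]0%R, 1%R[) \int[mu]_(z in `]a, x[)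
    (k z s)%:E)%E.
  apply: eq_integral => s; rewrite inE/= in_itv/= => s01.
  under [RHS]eq_integral do rewrite EFinM.
  rewrite ge0_integralZl_EFin//; last 3 first.
  - move=> z _; rewrite lee_fin !mulr_ge0 ?powR_ge0 ?subr_ge0//; exact: ltW.
  - apply/measurable_EFinP/measurable_funTS.
    apply: measurable_funM => //; apply: measurable_funM.
      exact: measurable_powR_subl.
    apply: (measurableT_comp (f := fun y : R => y `^ (q - 2))).
      exact: measurable_powR.
    by apply: measurable_funB => //; apply: measurable_funM => //;
      exact: measurable_funB.
  - exact: beta_weight_ge0.
  by rewrite abel_kernel_primitive// -EFinM.
rewrite -(@ge0_tonelli_setX _ `]a, x[%classic `]0%R, 1%R[%classic k)//;
  last first.
  exact: measurable_abel_kernel.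
transitivity (\int[mu]_(z in `]a, x[)
   (((1 - q) * (b - a) `^ m * B)%:E *
    (beta_weight a b (1 - q) (1 - p) z)%:E))%E.
  apply: eq_integral => z; rewrite inE/= in_itv/= => /andP[az zx].
  have zl : 0 < z - a < b - a by lra.
  have bz : 0 < b - z by lra.
  have za : 0 < z - a by lra.
  rewrite -EFinM mulrAC EFinM [X in (_ * X)%E]fineK//.
  rewrite -(moebius_integral pq zl) -ge0_integralZl_EFin//.
  - apply: eq_integral => s; rewrite inE/= in_itv/= => /andP[s0 s1].
    rewrite -EFinM; congr EFin; rewrite /k.
    have -> : b - a - (z - a) = b - z by lra.
    (* The power is multiplied and divided by the factors that [moebius_integral] carries for
       [l = b - a] and [v = z - a]. *)
    have -> : (z - a) `^ (- q) = (b - a) `^ m *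
        beta_weight a b (1 - q) (1 - p) z *
        ((b - a) `^ (1 - m) * (b - z) `^ p) / (b - a).
      rewrite -(powR_inv1 (ltW l0)) /beta_weight !powR_expR//.
      rewrite -!expRD; congr expR; ring.
    by field; rewrite gt_eqF.
  - by move=> s _; rewrite lee_fin !mulr_ge0 ?powR_ge0.
  - apply/measurable_EFinP/measurable_funTS.
    apply: measurable_funM => //; apply: measurable_funM.
      exact: measurable_beta_weight.
    apply: (measurableT_comp (f := fun y : R => y `^ (q - 2))).
      exact: measurable_powR.
    by apply: measurable_funB => //; exact: measurable_funM.
  - by rewrite !mulr_ge0 ?powR_ge0 ?beta_weight_ge0// subr_ge0 ltW.
have B_ge0 : 0 <= B.
  rewrite fine_ge0// integral_ge0// => s _.
  by rewrite lee_fin beta_weight_ge0.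
rewrite ge0_integralZl_EFin//.
- by move=> z _; rewrite lee_fin beta_weight_ge0.
- by apply/measurable_EFinP/measurable_funTS; exact: measurable_beta_weight.
- by rewrite !mulr_ge0 ?powR_ge0// subr_ge0 ltW.
Qed.

End AbelIdentity.

(** * Fractional integrals of antisymmetric weights *)

Section Potentials.
Context {R : realType}.
Implicit Types (f g v : R -> R) (a b c d m p q r s x y z : R).
Local Notation mu := lebesgue_measure.

Lemma integrable_oo_cc c d f :
  mu.-integrable `]c, d[ (EFin \o f) -> mu.-integrable `[c, d] (EFin \o f).
Proof.
move=> /integrableP[mf fi]; apply/integrableP.
have mcc g : measurable_fun `]c, d[ g -> measurable_fun `[c, d] g.
  move=> mg; apply/measurable_fun_itv_obnd_cbndP.
  exact/measurable_fun_itv_bndo_bndcP.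
have mf' : measurable_fun `]c, d[ f by exact/measurable_EFinP.
split; first by apply/measurable_EFinP; exact: mcc.
by rewrite integral_itv_bndoo//; exact: measurableT_comp.
Qed.

Lemma integrable_beta_weight_itv a b r s c d (b0 b1 : bool) :
  a < b -> 0 < r -> 0 < s -> a <= c -> d <= b ->
  mu.-integrable [set` Interval (BSide b0 c) (BSide b1 d)]
    (EFin \o beta_weight a b r s).
Proof.
move=> ab r0 s0 ac db.
apply: integrableS (integrable_oo_cc (integrable_beta_weight ab r0 s0)) => //.
by move: b0 b1 => [] [] x/=; rewrite !in_itv/= => /andP[? ?]; lra.
Qed.

(** An incomplete Beta function, transported to [[a, b]]. *)
Definition beta_primitive a b r s x : R :=
  \int[mu]_(y in `[a, x]) beta_weight a b r s y.

Lemma is_derive_beta_primitive a b r s x : 0 < r -> 0 < s -> a < x < b ->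
  is_derive x 1 (beta_primitive a b r s) (beta_weight a b r s x).
Proof.
move=> r0 s0 /andP[ax xb].
have H : mu.-integrable `[a, (x + b) / 2] (EFin \o beta_weight a b r s).
  by apply: integrable_beta_weight_itv => //; lra.
have xu : x < (x + b) / 2 by lra.
have cx : {for x, continuous (beta_weight a b r s)}.
  by apply: beta_weight_continuous; rewrite in_itv/= ax.
have [D1 D2] := continuous_FTC1_closed xu H ax cx.
by split; [exact: D1|rewrite -derive1E].
Qed.

Lemma beta_primitive_oo a b r s x : a < b -> 0 < r -> 0 < s -> x <= b ->
  beta_primitive a b r s x = \int[mu]_(y in `]a, x[) beta_weight a b r s y.
Proof.
move=> ab r0 s0 xb; rewrite /beta_primitive /Rintegral integral_itv_bndoo//.
by apply/measurable_EFinP/measurable_funTS; exact: measurable_beta_weight.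
Qed.

(** The right side of the Abel identity is finite because [1 - q] and [1 - p] are positive. Hence
    the singular integrand is integrable, which is what allows two such integrals to be
    subtracted. *)
Lemma abel_beta_primitive a b m p q : a < b -> 0 < p < 1 -> m < 1 -> q < 1 ->
  p + q = 1 + m ->
  exists C : R, forall x, a < x < b ->
    mu.-integrable `]a, x[
      (EFin \o (fun y => (x - y) `^ (- m) * beta_weight a b p q y)) /\
    \int[mu]_(y in `]a, x[) ((x - y) `^ (- m) * beta_weight a b p q y) =
    C * beta_primitive a b (1 - q) (1 - p) x.
Proof.
move=> ab /andP[p0 p1] m1 q1 pq.
have [C HC] := abel_beta_weight ab p0 m1 q1 pq.
exists C => x /[dup] axb /andP[ax xb].
have I : (\int[mu]_(y in `]a, x[) (beta_weight a b (1 - q) (1 - p) y)%:E)%E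
    \is a fin_num.
  apply: integrable_fin_num => //.
  by apply: integrable_beta_weight_itv; rewrite ?subr_gt0// ltW.
split.
  apply/integrableP; split.
    apply/measurable_EFinP/measurable_funTS/measurable_funM.
      exact: measurable_powR_subr.
    exact: measurable_beta_weight.
  under eq_integral do
    rewrite /= ger0_norm ?mulr_ge0 ?powR_ge0 ?beta_weight_ge0//.
  by rewrite HC// -(fineK I) -EFinM ltry.
rewrite beta_primitive_oo ?subr_gt0//; last exact: ltW.
by rewrite /Rintegral HC// -(fineK I) -EFinM.
Qed.

Lemma abel_reflect a b m p q x : a < x < b ->
  (\int[mu]_(y in `]x, b[) ((y - x)%R `^ (- m) * beta_weight a b p q y)%:E =
   \int[mu]_(y in `]a, (a + b - x)%R[)
     ((a + b - x - y)%R `^ (- m) * beta_weight a b q p y)%:E)%E.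
Proof.
move=> /andP[ax xb].
have aabx : a < a + b - x by lra.
have := @ge0_reflection_oo _ a (a + b - x) (a + b)
  (fun y => (y - x) `^ (- m) * beta_weight a b p q y) aabx.
have -> : a + b - (a + b - x) = x by lra.
have -> : a + b - a = b by lra.
move=> ->.
- apply: eq_integral => y _; congr EFin; rewrite beta_weight_reflect.
  by congr (_ `^ _ * _); lra.
- move=> y; rewrite in_itv/= => /andP[xy yb]; apply: cvgM.
    apply: cvg_powR_comp; first by rewrite subr_gt0.
    by apply: cvgB; [exact: cvg_id|exact: cvg_cst].
  by apply: beta_weight_continuous; rewrite in_itv/= (lt_trans ax).
- by move=> y _; rewrite mulr_ge0 ?powR_ge0 ?beta_weight_ge0.
Qed.

(** The endpoints form a null set. This serves the fractional integrals, which run over closed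
    intervals while the density is known only inside. *)
Lemma Rintegral_cc_oo c d f g :
  {in `]c, d[, f =1 g} -> mu.-integrable `]c, d[ (EFin \o g) ->
  \int[mu]_(y in `[c, d]) f y = \int[mu]_(y in `]c, d[) g y.
Proof.
move=> fg gi; rewrite /Rintegral integral_itv_bndoo.
  by congr fine; apply: eq_integral => y /[!inE]/= ycd; rewrite fg.
have mg : measurable_fun `]c, d[ (EFin \o g) by case/integrableP : gi.
apply: (eq_measurable_fun (EFin \o g)) mg => y /[!inE]/= ycd.
by rewrite /= fg.
Qed.

Lemma integrable_funrB c d f g : mu.-integrable `]c, d[ (EFin \o f) ->
  mu.-integrable `]c, d[ (EFin \o g) ->
  mu.-integrable `]c, d[ (EFin \o (fun y => f y - g y)).
Proof.
move=> fi gi; have : mu.-integrable `]c, d[ ((EFin \o f) \- (EFin \o g))%E.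
  exact: integrableB.
by apply: eq_integrable.
Qed.

(** Reflection about the midpoint exchanges the two weights, hence changes the sign of [v] and turns
    the right integral at [x] into the left one at [a + b - x]. Here [v] stands for a derivative
    that is known only on []a, b[]. *)
Lemma abel_antisymmetric a b m p q : a < b -> 0 < p < 1 -> 0 < q < 1 ->
  m < 1 -> p + q = 1 + m ->
  exists L : R -> R,
    (exists C1 C2 : R, forall x, a < x < b -> is_derive x 1 L
      (C1 * beta_weight a b (1 - q) (1 - p) x -
       C2 * beta_weight a b (1 - p) (1 - q) x)) /\
    forall v x, a < x < b ->
      {in `]a, b[, forall y, v y = beta_weight a b p q y -
                                   beta_weight a b q p y} ->
      \int[mu]_(y in `[a, x]) ((x - y) `^ (- m) * v y) = L x /\
      \int[mu]_(y in `[x, b]) ((y - x) `^ (- m) * v y) = - L (a + b - x).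
Proof.
move=> ab p01 q01 m1 pq; have /andP[p0 p1] := p01; have /andP[q0 q1] := q01.
have [C1 H1] := abel_beta_primitive ab p01 m1 q1 pq.
have qp : q + p = 1 + m by lra.
have [C2 H2] := abel_beta_primitive ab q01 m1 p1 qp.
exists (fun x => C1 * beta_primitive a b (1 - q) (1 - p) x -
  C2 * beta_primitive a b (1 - p) (1 - q) x); split.
  exists C1, C2 => x axb.
  have q1' : 0 < 1 - q by lra.
  have p1' : 0 < 1 - p by lra.
  have d1 := is_derive_beta_primitive q1' p1' axb.
  have d2 := is_derive_beta_primitive p1' q1' axb.
  apply: (is_derive_eq (is_deriveB (is_deriveZ C1 d1) (is_deriveZ C2 d2))).
  by [].
move=> v x axb vE; have /andP[ax xb] := axb.
have [i1 e1] := H1 x axb; have [i2 e2] := H2 x axb.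
have axb' : a < a + b - x < b by lra.
have [i1' e1'] := H1 _ axb'; have [i2' e2'] := H2 _ axb'.
split.
  rewrite (@Rintegral_cc_oo a x _ (fun y => (x - y) `^ (- m) *
    beta_weight a b p q y - (x - y) `^ (- m) * beta_weight a b q p y)).
  - by rewrite RintegralB// e1 e2.
  - move=> y; rewrite in_itv/= => /andP[ay yx].
    by rewrite vE ?mulrBr// in_itv/= ay (lt_trans yx).
  - exact: integrable_funrB.
(* Integrability of the right kernels is taken from the left ones at the reflected point, with the
   exponents exchanged. *)
have refl r s : (\int[mu]_(y in `]x, b[)
    `|((y - x)%R `^ (- m) * beta_weight a b r s y)%:E| =
   \int[mu]_(y in `]a, (a + b - x)%R[)
     `|((a + b - x - y)%R `^ (- m) * beta_weight a b s r y)%:E|)%E.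
  under eq_integral do
    rewrite /= ger0_norm ?mulr_ge0 ?powR_ge0 ?beta_weight_ge0//.
  rewrite abel_reflect//; apply: eq_integral => y _.
  by rewrite /= ger0_norm// mulr_ge0 ?powR_ge0 ?beta_weight_ge0.
have mr r s : measurable_fun `]x, b[
    (EFin \o (fun y => (y - x) `^ (- m) * beta_weight a b r s y)).
  apply/measurable_EFinP/measurable_funTS/measurable_funM.
    exact: measurable_powR_subl.
  exact: measurable_beta_weight.
have j1 : mu.-integrable `]x, b[
    (EFin \o (fun y => (y - x) `^ (- m) * beta_weight a b p q y)).
  apply/integrableP; split; first exact: mr.
  by rewrite [X in (X < _)%E](refl p q); case/integrableP : i2'.
have j2 : mu.-integrable `]x, b[
    (EFin \o (fun y => (y - x) `^ (- m) * beta_weight a b q p y)).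
  apply/integrableP; split; first exact: mr.
  by rewrite [X in (X < _)%E](refl q p); case/integrableP : i1'.
rewrite (@Rintegral_cc_oo x b _ (fun y => (y - x) `^ (- m) *
  beta_weight a b p q y - (y - x) `^ (- m) * beta_weight a b q p y)).
- rewrite RintegralB// -e1' -e2' opprB /Rintegral.
  by rewrite !abel_reflect.
- move=> y; rewrite in_itv/= => /andP[xy yb].
  by rewrite vE ?mulrBr// in_itv/= yb (lt_trans ax).
- exact: integrable_funrB.
Qed.

End Potentials.

(** * Hölder classes *)

Section Hoelder.
Context {R : realType}.
Implicit Types (f g : R -> R) (a b c l r s x y : R).

(** Subadditivity of the power: a fraction [z / x] in [[0, 1]] is at most its power of order
    [r <= 1], and the fractions of [y] and [x - y] add up to 1. *)
Lemma powR_subr_le x y r : 0 <= y <= x -> 0 < r <= 1 ->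
  x `^ r - y `^ r <= (x - y) `^ r.
Proof.
move=> /andP[y0 yx] /andP[r0 r1].
have [x0|x0] := leP x 0.
  have -> : x = 0 by lra.
  have -> : y = 0 by lra.
  by rewrite subrr powR_ge0.
have quot z : 0 <= z <= x -> z / x <= (z / x) `^ r.
  move=> /andP[]; rewrite le_eqVlt => /predU1P[<- _|z0 zx].
    by rewrite mul0r powR_ge0.
  by rewrite ger1_powR// divr_gt0//= ler_pdivrMr// mul1r.
have xr0 : 0 < x `^ r by rewrite powR_gt0.
have scale z : 0 <= z -> z `^ r = x `^ r * (z / x) `^ r.
  move=> z0; rewrite -powRM ?divr_ge0 ?(ltW x0)//.
  by congr (_ `^ _); field; rewrite gt_eqF.
rewrite lerBlDr (scale y)// (scale (x - y)); last by lra.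
rewrite -mulrDr ler_peMr ?(ltW xr0)//.
have h1 := quot y; have h2 := quot (x - y).
have -> : 1 = (x - y) / x + y / x by field; rewrite gt_eqF.
by apply: lerD; [apply: h2; lra|apply: h1; lra].
Qed.

Lemma powR_dist_le x y r : 0 <= x -> 0 <= y -> 0 < r <= 1 ->
  `|x `^ r - y `^ r| <= `|x - y| `^ r.
Proof.
move=> x0 y0 r01; have /andP[r0 _] := r01.
wlog xy : x y x0 y0 / y <= x.
  move=> H; have [|/ltW xy] := leP y x; first exact: H.
  by rewrite distrC (distrC x); exact: H.
rewrite ger0_norm ?subr_ge0; last by rewrite ge0_ler_powR// ?nnegrE// ltW.
by rewrite ger0_norm ?subr_ge0// powR_subr_le// y0.
Qed.

Lemma holder_bound_ge0 a b l f : holder_order a b l f ->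
  exists2 C : R, 0 <= C & forall x y, x \in `[a, b] -> y \in `[a, b] ->
    `|f x - f y| <= C * `|x - y| `^ l.
Proof.
move=> [C HC]; exists `|C| => // x y xab yab.
by rewrite (le_trans (HC x y xab yab))// ler_wpM2r ?powR_ge0// ler_norm.
Qed.

Lemma itv_dist_le a b x y : x \in `[a, b] -> y \in `[a, b] ->
  `|x - y| <= b - a.
Proof.
rewrite !in_itv/= => /andP[? ?] /andP[? ?].
by rewrite ler_norml; apply/andP; split; lra.
Qed.

(** On a bounded interval the surplus factor [|x - y|^(r - l)] is at most [(b - a)^(r - l)]. *)
Lemma holder_le_order a b l r f : 0 < l <= r ->
  holder_order a b r f -> holder_order a b l f.
Proof.
move=> /andP[l0 lr] /holder_bound_ge0[C C0 HC].
exists (C * (b - a) `^ (r - l)) => x y xab yab.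
apply: (le_trans (HC x y xab yab)); rewrite -mulrA ler_wpM2l//.
have -> : `|x - y| `^ r = `|x - y| `^ (r - l) * `|x - y| `^ l.
  rewrite -powRD; first by rewrite subrK.
  by rewrite subrK gt_eqF// (lt_le_trans l0).
have ba := itv_dist_le xab yab.
rewrite ler_wpM2r ?powR_ge0// ge0_ler_powR ?subr_ge0// ?nnegrE//.
exact: le_trans ba.
Qed.

Lemma holder_bounded a b l f : holder_order a b l f -> 0 <= l -> a <= b ->
  exists2 M : R, 0 <= M & forall x, x \in `[a, b] -> `|f x| <= M.
Proof.
move=> /holder_bound_ge0[C C0 HC] l0 ab.
have aab : a \in `[a, b] by rewrite in_itv/= lexx.
exists (`|f a| + C * (b - a) `^ l) => [|x xab].
  by rewrite addr_ge0// mulr_ge0// powR_ge0.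
rewrite -[f x](subrK (f a)) addrC (le_trans (ler_normD _ _))// lerD2l.
apply: (le_trans (HC x a xab aab)); rewrite ler_wpM2l//.
by rewrite ge0_ler_powR// ?nnegrE ?subr_ge0// itv_dist_le.
Qed.

Lemma holder_order_cst a b l (k : R) : holder_order a b l (cst k).
Proof. by exists 0 => x y _ _; rewrite subrr normr0 mul0r. Qed.

Lemma holder_order_add a b l f g : holder_order a b l f ->
  holder_order a b l g -> holder_order a b l (fun x => f x + g x).
Proof.
move=> [C HC] [D HD]; exists (C + D) => x y xab yab.
rewrite opprD addrACA mulrDl.
apply: (le_trans (ler_normD _ _)); apply: lerD; [exact: HC|exact: HD].
Qed.

Lemma holder_order_mul a b l f g : 0 <= l -> a <= b -> holder_order a b l f ->
  holder_order a b l g -> holder_order a b l (fun x => f x * g x).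
Proof.
move=> l0 ab hf hg.
have [M M0 HM] := holder_bounded hf l0 ab.
have [N N0 HN] := holder_bounded hg l0 ab.
have [C C0 HC] := holder_bound_ge0 hf.
have [D D0 HD] := holder_bound_ge0 hg.
exists (M * D + C * N) => x y xab yab.
have -> : f x * g x - f y * g y = f x * (g x - g y) + (f x - f y) * g y.
  by ring.
rewrite (mulrDl (M * D)); apply: (le_trans (ler_normD _ _)).
rewrite !normrM lerD//.
  by rewrite -mulrA ler_pM// ?HM// HD.
by rewrite mulrAC ler_pM// ?HC// HN.
Qed.

Lemma holder_powR_subl a b l r : 0 < l <= r -> r <= 1 ->
  holder_order a b l (fun x => (x - a) `^ r).
Proof.
move=> /andP[l0 lr] r1; apply: (@holder_le_order _ _ _ r); first exact/andP.
exists 1 => x y; rewrite !in_itv/= => /andP[ax _] /andP[ay _].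
rewrite mul1r; have -> : x - y = x - a - (y - a) by lra.
by apply: powR_dist_le; rewrite ?subr_ge0// r1 (lt_le_trans l0).
Qed.

Lemma holder_powR_subr a b l r : 0 < l <= r -> r <= 1 ->
  holder_order a b l (fun x => (b - x) `^ r).
Proof.
move=> /andP[l0 lr] r1; apply: (@holder_le_order _ _ _ r); first exact/andP.
exists 1 => x y; rewrite !in_itv/= => /andP[_ xb] /andP[_ yb].
rewrite mul1r distrC; have -> : x - y = b - y - (b - x) by lra.
by apply: powR_dist_le; rewrite ?subr_ge0// r1 (lt_le_trans l0).
Qed.

(** Multiplying by [(x - a)^(1-e) (b - x)^(1-e)] changes the exponents into [r - e] and [s - e]. For
    [e] below both [r] and [s] these are positive, so the numerator [g] is Hölder continuous and
    vanishes at both ends. *)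
Lemma Hstar_beta_weight a b r s (k : R) : a < b -> 0 < r < 1 -> 0 < s < 1 ->
  Hstar a b (fun x => k * (beta_weight a b r s x + beta_weight a b s r x)).
Proof.
move=> ab /andP[r0 r1] /andP[s0 s1].
pose e := Num.min r s / 2.
have [er es e0] : [/\ e < r, e < s & 0 < e].
  by rewrite /e; case: (leP r s) => rs; split; lra.
pose l := Num.min (r - e) (s - e).
have [lr ls l0] : [/\ l <= r - e, l <= s - e & 0 < l].
  by rewrite /l; case: (leP (r - e) (s - e)) => rs; split; lra.
pose g x := k * ((x - a) `^ (r - e) * (b - x) `^ (s - e) +
                 (x - a) `^ (s - e) * (b - x) `^ (r - e)).
exists l, e, e; split => //; first by rewrite l0; lra.
exists g.
  split.
  - have l0' := ltW l0; have ab' := ltW ab.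
    apply: holder_order_mul => //; first exact: holder_order_cst.
    by apply: holder_order_add; apply: holder_order_mul => //;
      (apply: holder_powR_subl || apply: holder_powR_subr);
      rewrite ?l0//; lra.
  - by rewrite /g subrr !powR0 ?gt_eqF ?subr_gt0// !mul0r addr0 mulr0.
  - by rewrite /g subrr !powR0 ?gt_eqF ?subr_gt0// !mulr0 addr0 mulr0.
move=> x; rewrite in_itv/= => /andP[ax xb].
have xa0 : 0 < x - a by rewrite subr_gt0.
have bx0 : 0 < b - x by rewrite subr_gt0.
have pw y t : 0 < y -> y `^ (t - e) = y `^ (t - 1) * y `^ (1 - e).
  by move=> y0; rewrite !powR_expR// -expRD; congr expR; ring.
rewrite /g /beta_weight (pw _ r xa0) (pw _ s bx0) (pw _ s xa0) (pw _ r bx0).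
have := powR_gt0 (1 - e) xa0; have := powR_gt0 (1 - e) bx0.
move: (_ `^ (1 - e)) (_ `^ (1 - e)) => Y X Y0 X0.
move: (_ `^ (r - 1)) (_ `^ (s - 1)) (_ `^ (s - 1)) (_ `^ (r - 1)) => A B C D.
by field; rewrite !gt_eqF.
Qed.

End Hoelder.

(** * Absolute continuity of primitives *)

Section AbsoluteContinuity.
Context {R : realType}.
Implicit Types (f : R -> R) (a b c d x y : R).
Local Notation mu := lebesgue_measure.

(** The integral of [|f|] over a set is small when the measure of the set is small; this is applied
    to the union [A] of the given disjoint intervals. *)
Lemma absolutely_continuous_primitive a b f :
  mu.-integrable `[a, b] (EFin \o f) ->
  absolutely_continuous a b (fun x => \int[mu]_(y in `[a, x]) f y).
Proof.
move=> fi e e0.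
have Fi : mu.-integrable setT (EFin \o f \_ `[a, b]).
  by rewrite -restrict_EFin; apply/integrable_restrict => //=; rewrite setTI.
have [d [d0 dP]] := integral_normr_continuous Fi e0.
exists d => // n l r lr tlr sumd.
pose A := \big[setU/set0]_(i < n) `]l i, r i[%classic.
have mA : measurable A by apply: bigsetU_measurable.
have tA : trivIset [set` index_enum 'I_n] (fun i => `]l i, r i[%classic).
  exact: sub_trivIset tlr.
have mItv i : measurable `]l i, r i[%classic by [].
have muA : (mu A = \sum_(i < n) (r i - l i)%:E)%E.
  rewrite -[LHS]mul1e -integral_cst//.
  rewrite /A (ge0_integral_bigsetU mu _ (index_enum_uniq _) tA)//.
  apply: eq_bigr => i _; rewrite integral_cst// mul1e.
  etransitivity; first exact: (lebesgue_measure_itv `]l i, r i[).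
  (* An interval may be empty: [l i = r i] is allowed, and its length is then 0. *)
  rewrite /= lte_fin; have [_ lri _] := lr i.
  by case: ltP => // ril; rewrite (_ : r i = l i) ?subrr//; lra.
have mAd : (mu A < d%:E)%E by rewrite muA sumEFin lte_fin.
have := dP A mA mAd.
apply: le_lt_trans.
have FiS i : mu.-integrable `]l i, r i[ (EFin \o f).
  apply: integrableS fi => // x /=; rewrite !in_itv/= => /andP[? ?].
  by have [? ? ?] := lr i; lra.
have nF x : A x -> (0 <= `|(f \_ `[a, b]) x|%:E)%E by rewrite lee_fin.
have mnF : measurable_fun A (fun x => `|(f \_ `[a, b]) x|%:E).
  apply: measurable_funTS; apply/measurable_EFinP.
  apply: measurableT_comp => //.
  by case/integrableP : Fi => /measurable_EFinP.
have E : (\int[mu]_(x in A) `|(f \_ `[a, b]) x|%:E =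
    \sum_(i < n) (\int[mu]_(x in `]l i, r i[) `|f x|)%:E)%E.
  rewrite /A (ge0_integral_bigsetU mu _ (index_enum_uniq _) tA)//.
  apply: eq_bigr => i _; rewrite /Rintegral fineK.
    apply: eq_integral => x; rewrite inE/= in_itv/= => /andP[? ?].
    rewrite patchE mem_set//= in_itv/=.
    by have [? ? ?] := lr i; apply/andP; split; lra.
  apply: integrable_fin_num => //.
  by have := integrable_norm (FiS i).
rewrite [leRHS]/Rintegral E sumEFin /=.
apply: ler_sum => i _; have [ali lri rib] := lr i.
have fiar : mu.-integrable `[a, r i] (EFin \o f).
  apply: integrableS fi => // x /=; rewrite !in_itv/= => /andP[? ?]; lra.
(* The increment of the primitive is an integral over []l i, r i]], which differs from the open
   interval in [A] by a null set. *)
rewrite (@Rintegral_itvB _ f (BLeft a) (BRight (r i)) (l i))//.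
have filr : mu.-integrable `]l i, r i] (EFin \o f).
  apply: integrableS fi => // x /=; rewrite !in_itv/= => /andP[? ?]; lra.
apply: (le_trans (le_normr_Rintegral _ filr)) => //.
rewrite le_eqVlt; apply/orP; left; apply/eqP.
apply/esym; apply: Rintegral_itv_bndo_bndc.
by have := integrable_norm (FiS i).
Qed.

End AbsoluteContinuity.

(** * Constant coefficients and the sign of the cotangent *)

Section Constants.
Context {R : realType}.
Implicit Types (a b k x y : R).
Local Notation mu := lebesgue_measure.

(** Every point of [[a, b]] is a limit of other points of it, from the right if [x < b] and from the
    left at [b]. This makes the limit in [derive_within] unique, also at the endpoints. *)
Lemma within_itv_dnbhs_proper a b x : a < b -> x \in `[a, b] ->
  ProperFilter (within `[a, b] x^').
Proof.
move=> ab; rewrite in_itv/= => /andP[ax xb].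
apply: Build_ProperFilter_ex => P wP.
have {wP} : nbhs x (fun y => y != x -> y \in `[a, b] -> P y) by exact: wP.
move=> /nbhs_ballP[e /= e0 eP].
have [xb'|bx] := ltP x b.
  pose h := Num.min e (b - x) / 2.
  have [h0 he hb] : [/\ 0 < h, h < e & h < b - x].
    by rewrite /h; case: (leP e (b - x)) => ?; split; lra.
  exists (x + h); apply: eP; rewrite /ball/=.
  - by rewrite opprD addNKr normrN gtr0_norm.
  - by rewrite gt_eqF// ltrDl.
  - by rewrite in_itv/=; lra.
pose h := Num.min e (b - a) / 2.
have [h0 he hb] : [/\ 0 < h, h < e & h < b - a].
  by rewrite /h; case: (leP e (b - a)) => ?; split; lra.
exists (x - h); apply: eP; rewrite /ball/=.
- by rewrite opprB addrC subrK gtr0_norm.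
- by rewrite lt_eqF// gtrDl oppr_lt0.
- by rewrite in_itv/=; lra.
Qed.

Lemma derive_within_cst a b k x : a < b -> x \in `[a, b] ->
  derive_within `[a, b] (cst k) x = 0.
Proof.
move=> ab xab; rewrite /derive_within.
under eq_fun do rewrite /= subrr mul0r.
have PF := within_itv_dnbhs_proper ab xab.
exact: lim_cst.
Qed.

Lemma C1_on_cst a b k : a < b -> C1_on `[a, b] (cst k).
Proof.
move=> ab; split=> [x _|].
  rewrite /derivable_within; under eq_fun do rewrite /= subrr mul0r.
  exact: is_cvg_cst.
apply: (@subspace_eq_continuous _ _ _ (cst 0)).
  by move=> x /[!inE] xab; apply: esym; exact: (derive_within_cst k ab xab).
by apply: continuous_subspaceT => x; exact: cst_continuous.
Qed.

Lemma holder_derive_within_cst a b k : a < b ->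
  holder a b (derive_within `[a, b] (cst k)).
Proof.
move=> ab; exists 1 => //; exists 0 => x y xab yab.
by rewrite !derive_within_cst// subrr normr0 mul0r.
Qed.

(** The complement of []a, b[] is null for the restricted measure, so [f] vanishes almost
    everywhere. *)
Lemma Linfty_norm_eq0 a b (f : R -> R) :
  {in `]a, b[, forall x, f x = 0} -> Linfty_norm a b f = 0%E.
Proof.
move=> f0; rewrite /Linfty_norm unlock /=; case: ifPn => // mu0.
apply: ess_sup_ae_cst => //.
exists (~` `]a, b[%classic); split.
- exact: measurableC.
- by rewrite /= /mrestr setICl measure0.
- move=> x /= H xab; apply: H; rewrite f0 ?normr0//.
Qed.

(** The angle lies strictly between [pi / 2] and [pi]; shifting it by [pi / 2] turns the cotangent
    into minus the tangent of [m pi / 2]. *)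
Lemma cot_half_lt0 (m : R) : 0 < m < 1 ->
  pi * (1 - m ^+ 2) * cot ((1 + m) * pi / 2) < 0.
Proof.
move=> /andP[m0 m1]; have p0 := pi_gt0 R.
have h0 : 0 < m * pi / 2 by rewrite divr_gt0// mulr_gt0.
have h1 : m * pi / 2 < pi / 2 by rewrite ltr_pM2r// gtr_pMl.
rewrite pmulr_rlt0; last first.
  by rewrite mulr_gt0// subr_gt0 expr_lt1// ltW.
have -> : (1 + m) * pi / 2 = m * pi / 2 + pi / 2 by lra.
rewrite /cot cosDpihalf sinDpihalf mulNr oppr_lt0 divr_gt0//.
  by apply: sin_gt0_pi; apply/andP; split => //; lra.
by apply: cos_gt0_pihalf; apply/andP; split => //; lra.
Qed.

End Constants.

(** * Growth at the left endpoint *)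

Section BoundaryGrowth.
Context {R : realType}.
Implicit Types (f g J : R -> R) (a b e l p q r s t x y : R).
Local Notation mu := lebesgue_measure.

Lemma holder_continuous a b l f : 0 < l -> holder_order a b l f ->
  {in `]a, b[, continuous f}.
Proof.
move=> l0 /holder_bound_ge0[C C0 HC] x xab.
apply/cvgrPdist_le => e e0.
(* [d] solves [(C + 1) d^l = e]; the added 1 covers [C = 0]. *)
pose d := (e / (C + 1)) `^ l^-1.
have eC : 0 < e / (C + 1) by rewrite divr_gt0//; lra.
have d0 : 0 < d by rewrite powR_gt0.
have dl : d `^ l = e / (C + 1).
  by rewrite /d -powRrM mulVf ?gt_eqF// powRr1// ltW.
have sub := subset_itv_oo_cc.
near=> y.
have yab : y \in `]a, b[ by near: y; exact: near_in_itvoo.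
have xyd : `|x - y| <= d.
  by near: y; apply: cvgr_dist_le => //; exact: cvg_id.
apply: (le_trans (HC x y (sub _ _ _ _ _ xab) (sub _ _ _ _ _ yab))).
rewrite (@le_trans _ _ (C * d `^ l))//.
  by rewrite ler_wpM2l// ge0_ler_powR ?nnegrE// ltW.
rewrite dl mulrA ler_pdivrMr; last lra.
by rewrite mulrDr mulr1 mulrC lerDl ltW.
Unshelve. all: by end_near. Qed.

(** Left of the midpoint [|J|] is at most a constant times [(y - a)^(e1-1)], and the kernel is at
    most [(x - a)^(t-1)] because [t >= 1]. Integrating the product gains the exponent [e1], which
    serves as [e]. *)
Lemma fracint_left_Hstar_le a b t J : a < b -> 1 <= t -> Hstar a b J ->
  exists M e, 0 < e /\ forall x, a < x <= (a + b) / 2 ->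
    `|fracint_left a t J x| <= M * (x - a) `^ (t - 1 + e).
Proof.
move=> ab t1 [l [e1 [e2 [/andP[l0 l1] e10 e20 [g [hg _ _] Jg]]]]].
have JE y : y \in `]a, b[ -> J y = g y * beta_weight a b e1 e2 y.
  move=> /Jg ->; rewrite /beta_weight.
  by rewrite -(opprB 1 e1) -(opprB 1 e2) !powRN invfM.
have cg := holder_continuous l0 hg.
have [N N0 HN] := holder_bounded hg (ltW l0) (ltW ab).
(* [D] bounds [(b - y)^(e2-1)] on the left half, where [b - y] lies between [(b - a) / 2] and
   [b - a]. *)
pose D := ((b - a) / 2) `^ (e2 - 1) + (b - a) `^ (e2 - 1).
have D0 : 0 <= D by rewrite addr_ge0// powR_ge0.
exists (`|(Gamma t)^-1| * (N * D / e1)), e1; split => // x /andP[ax xm].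
have xb : x < b by lra.
have xab y : y \in `]a, x[ -> y \in `]a, b[.
  by rewrite !in_itv/= => /andP[? ?]; lra.
pose H y := (x - a) `^ (t - 1) * (N * D) * (y - a) `^ (e1 - 1).
have Hi : mu.-integrable `]a, x[ (EFin \o H).
  have : mu.-integrable `]a, x[ (fun y => ((x - a) `^ (t - 1) * (N * D))%:E *
      ((y - a)%R `^ (e1 - 1)%R)%:E)%E.
    by apply: integrableZl => //; exact: integrable_powR_subl.
  by apply: eq_integrable.
have JH y : y \in `]a, x[ -> `|(x - y) `^ (t - 1) * J y| <= H y.
  move=> /[dup] yax; rewrite in_itv/= => /andP[ay yx].
  rewrite (JE _ (xab _ yax)) /beta_weight normrM /H -!mulrA.
  rewrite ger0_norm ?powR_ge0//; apply: ler_pM; rewrite ?powR_ge0//.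
    by rewrite ge0_ler_powR ?nnegrE ?subr_ge0//; lra.
  rewrite normrM; apply: ler_pM => //.
    by apply: HN; exact: subset_itv_oo_cc (xab _ yax).
  rewrite ger0_norm ?mulr_ge0 ?powR_ge0// mulrC ler_wpM2r ?powR_ge0//.
  by apply: powR_le_ends; lra.
have mJ : measurable_fun `]a, x[ (fun y => (x - y) `^ (t - 1) * J y).
  apply: (eq_measurable_fun (fun y => (x - y) `^ (t - 1) *
      (g y * beta_weight a b e1 e2 y))).
    by move=> y /[!inE]/= yax; rewrite JE//; exact: xab.
  apply: measurable_funM.
    by apply: measurable_funTS; exact: measurable_powR_subr.
  apply: measurable_funM.
    by apply: oo_continuous_measurable => y yax; apply: cg; exact: xab.
  by apply: measurable_funTS; exact: measurable_beta_weight.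
have Ji : mu.-integrable `]a, x[ (EFin \o (fun y => (x - y) `^ (t - 1) * J y)).
  apply: (le_integrable _ _ _ Hi) => //; first exact/measurable_EFinP.
  by move=> y yax /=; rewrite lee_fin (le_trans (JH y yax))// ler_norm.
rewrite /fracint_left normrM -!mulrA ler_wpM2l//.
rewrite (@Rintegral_cc_oo _ a x _ (fun y => (x - y) `^ (t - 1) * J y))//.
apply: (le_trans (le_normr_Rintegral _ Ji)) => //.
have nJi := integrable_norm Ji.
apply: (@le_trans _ _ (\int[mu]_(y in `]a, x[) H y)).
  by apply: le_Rintegral => // y; exact: JH.
rewrite RintegralZl//; last exact: integrable_powR_subl.
rewrite {1}/Rintegral integral_powR_subl//= (@powRD _ _ (t - 1)); last first.
  by apply/implyP => _; rewrite gt_eqF// subr_gt0.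
rewrite le_eqVlt; apply/orP; left; apply/eqP; ring.
Qed.

(** The ratio of [w(q, p)] to [w(p, q)] is [((y - a) / (b - y))^(q-p)], which is small near [a].
    Where it is at most 1/2, the difference is at least half of [w(p, q)], hence at least a constant
    times [(y - a)^(p-1)]. *)
Lemma beta_primitive_sub_ge a b p q : a < b -> 0 < p -> p < q -> q <= 1 ->
  exists c d : R, [/\ 0 < c, 0 < d & forall x, a < x < a + d -> x < b ->
    c * (x - a) `^ p <= beta_primitive a b p q x - beta_primitive a b q p x].
Proof.
move=> ab p0 pq q1; have q0 : 0 < q by lra.
(* The ratio is at most 1/2 as soon as [y - a <= k (b - y)]. *)
pose k : R := 2^-1 `^ (q - p)^-1.
have k0 : 0 < k by rewrite powR_gt0.
have kE : k `^ (q - p) = 2^-1.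
  by rewrite /k -powRrM mulVf ?powRr1// gt_eqF// subr_gt0.
have l0 : 0 < b - a by rewrite subr_gt0.
have L0 : 0 < (b - a) `^ (q - 1) by rewrite powR_gt0.
pose h := (b - a) / 2; have h0 : 0 < h by rewrite /h; lra.
(* The bound [h] keeps [b - y >= h], and then [k * h] gives [y - a <= k (b - y)]. The divisor [p] in
   the constant comes from integrating [(y - a)^(p-1)]. *)
exists ((b - a) `^ (q - 1) / 2 / p), (Num.min h (k * h)).
split; first by rewrite !divr_gt0.
  by rewrite lt_min h0 mulr_gt0.
move=> x /andP[ax xd] xb.
have [xh xkh] : x - a < h /\ x - a < k * h.
  by move: xd; rewrite -ltrBlDl lt_min => /andP.
have I1 : mu.-integrable `]a, x[ (EFin \o beta_weight a b p q).
  by apply: integrable_beta_weight_itv => //; exact: ltW.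
have I2 : mu.-integrable `]a, x[ (EFin \o beta_weight a b q p).
  by apply: integrable_beta_weight_itv => //; exact: ltW.
have I0 : mu.-integrable `]a, x[ (EFin \o (fun y => (y - a) `^ (p - 1))).
  exact: integrable_powR_subl.
rewrite !beta_primitive_oo//; try exact: ltW.
rewrite -RintegralB//.
have -> : (b - a) `^ (q - 1) / 2 / p * (x - a) `^ p =
    \int[mu]_(y in `]a, x[) ((b - a) `^ (q - 1) / 2 * (y - a) `^ (p - 1)).
  by rewrite RintegralZl// [in RHS]/Rintegral integral_powR_subl//=; ring.
apply: le_Rintegral => //.
- have : mu.-integrable `]a, x[ (fun y => ((b - a) `^ (q - 1) / 2)%:E *
      ((y - a)%R `^ (p - 1)%R)%:E)%E by exact: integrableZl.
  by apply: eq_integrable.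
- exact: integrable_funrB.
move=> y; rewrite /= in_itv/= => /andP[ay yx].
have ya : 0 < y - a by rewrite subr_gt0.
have yb : 0 < b - y by lra.
have hb : h <= b - y by move: xh; rewrite /h; lra.
have ykb : y - a <= k * (b - y).
  by apply: (@le_trans _ _ (k * h)); [lra|rewrite ler_pM2l].
have sm : (y - a) `^ (q - p) <= 2^-1 * (b - y) `^ (q - p).
  by rewrite -kE -powRM ?(ltW k0) ?(ltW yb)// ge0_ler_powR ?nnegrE//;
    rewrite ?subr_ge0 ?mulr_ge0 ?ltW//; lra.
have e1 : beta_weight a b q p y =
    (y - a) `^ (p - 1) * (b - y) `^ (p - 1) * (y - a) `^ (q - p).
  by rewrite /beta_weight !powR_expR// -!expRD; congr expR; ring.
have e2 : beta_weight a b p q y =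
    (y - a) `^ (p - 1) * (b - y) `^ (p - 1) * (b - y) `^ (q - p).
  by rewrite /beta_weight !powR_expR// -!expRD; congr expR; ring.
have bq : (b - a) `^ (q - 1) <= (b - y) `^ (q - 1).
  by rewrite !powR_expR// ler_expR ler_wnM2l ?subr_le0// ler_ln//; lra.
have Y0 : 0 <= (y - a) `^ (p - 1) by rewrite powR_ge0.
have P0 : 0 <= (y - a) `^ (p - 1) * (b - y) `^ (p - 1).
  by rewrite mulr_ge0// powR_ge0.
apply: (@le_trans _ _ (2^-1 * beta_weight a b p q y)).
  by rewrite /beta_weight; have := ler_wpM2l Y0 bq; lra.
have := ler_wpM2l P0 sm; rewrite -e1 mulrCA -e2; lra.
Qed.

End BoundaryGrowth.

(** * The counterexample *)

Section Assembly.
Context {R : realType}.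
Implicit Types (f g u J : R -> R) (a b c d m p q r s t x y : R).
Local Notation mu := lebesgue_measure.

Lemma is_derive_eq_oo a b f g x (dg : R) : {in `]a, b[, f =1 g} ->
  x \in `]a, b[ -> is_derive x 1 g dg -> is_derive x 1 f dg.
Proof.
move=> fg xab dgx.
have gf : {near x, g =1 f}.
  by near=> y; apply: esym; apply: fg; near: y; exact: near_in_itvoo.
have gf' : {near x, f =1 g}.
  by near=> y; apply: fg; near: y; exact: near_in_itvoo.
split.
  by apply: (near_eq_derivable gf); exact: ex_derive.
by rewrite (near_eq_derive _ gf') derive_val.
Unshelve. all: by end_near. Qed.

(** The reflection that exchanges the weights preserves their total integral; this gives
    [u b = 0]. *)
Lemma beta_primitive_sym a b r s : a < b -> 0 < r -> 0 < s ->
  beta_primitive a b r s b = beta_primitive a b s r b.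
Proof.
move=> ab r0 s0; rewrite !beta_primitive_oo// /Rintegral.
have := @ge0_reflection_oo _ a b (a + b) (beta_weight a b r s) ab.
have -> : a + b - b = a by lra.
have -> : a + b - a = b by lra.
move=> ->.
- by congr fine; apply: eq_integral => y _; rewrite beta_weight_reflect.
- exact: beta_weight_continuous.
- by move=> y _; exact: beta_weight_ge0.
Qed.

(** The solution [u], written as a difference of primitives so that each term can be estimated and
    differentiated separately. *)
Definition antisym_solution a b p q x : R :=
  beta_primitive a b p q x - beta_primitive a b q p x.

Lemma antisym_solution_ac a b p q : a < b -> 0 < p -> 0 < q ->
  absolutely_continuous a b (antisym_solution a b p q).
Proof.
move=> ab p0 q0.
have ui : mu.-integrable `[a, b] (EFin \o (fun y => beta_weight a b p q y -
    beta_weight a b q p y)).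
  by apply: integrable_oo_cc; apply: integrable_funrB;
    exact: integrable_beta_weight.
move=> e e0; have [d d0 H] := absolutely_continuous_primitive ui e0.
exists d => // n l r lr tlr sumd; have := H n l r lr tlr sumd.
have uE x : x <= b -> antisym_solution a b p q x = \int[mu]_(y in `[a, x])
    (beta_weight a b p q y - beta_weight a b q p y).
  move=> xb; rewrite RintegralB//; exact: integrable_beta_weight_itv.
under eq_bigr => i _.
  have [ali lri rib] := lr i.
  rewrite -!uE//; last exact: le_trans rib.
  over.
by [].
Qed.

Lemma is_derive_antisym_solution a b p q x : 0 < p -> 0 < q -> a < x < b ->
  is_derive x 1 (antisym_solution a b p q)
    (beta_weight a b p q x - beta_weight a b q p x).
Proof.
move=> p0 q0 axb.
have d1 := is_derive_beta_primitive p0 q0 axb.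
have d2 := is_derive_beta_primitive q0 p0 axb.
exact: is_deriveB.
Qed.

Lemma derive1_antisym_solution a b p q : 0 < p -> 0 < q ->
  {in `]a, b[, forall x, (antisym_solution a b p q)^`()%classic x =
    beta_weight a b p q x - beta_weight a b q p x}.
Proof.
move=> p0 q0 x; rewrite in_itv/= => axb.
have D := is_derive_antisym_solution p0 q0 axb.
by rewrite derive1E derive_val.
Qed.

(** With equal weights 1/2 the flux is a multiple of [L x - L (a + b - x)], where [L] is the left
    integral of [abel_antisymmetric]. *)
Lemma is_derive_flux_antisym a b m p q : a < b -> 0 < p < 1 -> 0 < q < 1 ->
  m < 1 -> p + q = 1 + m ->
  exists c : R, forall x, x \in `]a, b[ ->
    is_derive x 1 (frac_flux a b m 2^-1 2^-1 (antisym_solution a b p q))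
      (c * (beta_weight a b (1 - q) (1 - p) x +
            beta_weight a b (1 - p) (1 - q) x)).
Proof.
move=> ab p01 q01 m1 pq; have /andP[p0 _] := p01; have /andP[q0 _] := q01.
have [L [[C1 [C2 dL]] HL]] := abel_antisymmetric ab p01 q01 m1 pq.
pose K := 2^-1 * (Gamma (1 - m))^-1.
(* Reflection swaps the two weights in the derivative of [L], so both of them end up with the
   coefficient [C1 - C2]. *)
exists (K * (C1 - C2)) => x xab.
apply: (@is_derive_eq_oo a b _ (fun x => K * (L x - L (a + b - x)))) => //.
  move=> y yab; have ayb : a < y < b by move: yab; rewrite in_itv.
  have [e1 e2] := HL _ y ayb (derive1_antisym_solution p0 q0).
  rewrite /frac_flux /fracint_left /fracint_right.
  have -> : 1 - m - 1 = - m by lra.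
  by rewrite e1 e2 /K; ring.
have axb : a < x < b by move: xab; rewrite in_itv.
have axb' : a < a + b - x < b by lra.
have d1 := dL x axb; have d2 := dL _ axb'.
have dB : is_derive x (1 : R) (fun y : R => a + b - y : R) (- 1 : R).
  by apply: is_derive_eq; rewrite add0r mul1r.
have d3 := @is_derive1_comp _ L (fun y => a + b - y) x _ _ d2 dB.
apply: (is_derive_eq (is_deriveZ K (is_deriveB d1 d3))).
by rewrite !beta_weight_reflect /GRing.scale/=; ring.
Qed.

(** After division by [(x - a)^p] the two growth bounds would give [c <= M (x - a)^r] near [a], with
    [r >= e > 0] since [p <= t - 1]; the right side tends to 0. *)
Lemma antisym_solution_not_fracint a b p q t J : a < b -> 0 < p -> p < q ->
  q <= 1 -> 1 <= t -> p <= t - 1 -> Hstar a b J ->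
  ~ (forall x, x \in `]a, b[ -> antisym_solution a b p q x =
       fracint_left a t J x).
Proof.
move=> ab p0 pq q1 t1 pt HJ uJ.
have [M [e [e0 HM]]] := fracint_left_Hstar_le ab t1 HJ.
have [c [d [c0 d0 Hc]]] := beta_primitive_sub_ge ab p0 pq q1.
pose r := t - 1 + e - p.
have r0 : 0 < r by rewrite /r; lra.
have Mr : M * (x - a) `^ r @[x --> a^'+] --> M * 0.
  by apply: cvgM; [exact: cvg_cst|exact: cvg_subr_powR_right].
rewrite mulr0 in Mr.
have lt_c := cvgr_lt 0 Mr c c0.
have [x [xa xd xh xc]] : exists x, [/\ a < x, x < a + d, x < (a + b) / 2 &
    M * (x - a) `^ r < c].
  have : \forall x \near a^'+, [/\ a < x, x < a + d, x < (a + b) / 2 &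
      M * (x - a) `^ r < c].
    near=> x; split; near: x; [exact: nbhs_right_gt|apply: nbhs_right_lt; lra
      |apply: nbhs_right_lt; lra|exact: lt_c].
  by move=> /filter_ex.
have xb : x < b by lra.
have xa0 : 0 < x - a by rewrite subr_gt0.
have h1 : c * (x - a) `^ p <= antisym_solution a b p q x.
  by apply: Hc => //; rewrite xa.
have h2 : antisym_solution a b p q x <= M * (x - a) `^ (t - 1 + e).
  rewrite uJ; last by rewrite in_itv/= xa.
  by apply: (le_trans (ler_norm _)); apply: HM; rewrite xa ltW.
have := le_trans h1 h2; apply/negP; rewrite -ltNge.
have -> : (x - a) `^ (t - 1 + e) = (x - a) `^ r * (x - a) `^ p.
  by rewrite !powR_expR// -expRD /r; congr expR; ring.
by rewrite mulrA ltr_pM2r// powR_gt0.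
Unshelve. all: by end_near. Qed.

Lemma antisym_true_solution a b m p q : a < b -> 0 < p < 1 -> 0 < q < 1 ->
  m < 1 -> p + q = 1 + m ->
  exists c : R, true_solution a b m 2^-1 2^-1 (cst 1) (cst 0) (cst 0)
    (fun x => c * (beta_weight a b (1 - q) (1 - p) x +
                   beta_weight a b (1 - p) (1 - q) x))
    (antisym_solution a b p q).
Proof.
move=> ab p01 q01 m1 pq; have /andP[p0 _] := p01; have /andP[q0 _] := q01.
have [c dF] := is_derive_flux_antisym ab p01 q01 m1 pq.
have nbx x : x \in `]a, b[ -> nbhs x `]a, b[%classic.
  by move=> xab; exact: near_in_itvoo.
(* The sign is that of the leading minus in [frac_operator]. *)
exists (- c); split.
- exact: antisym_solution_ac.
- split; last by rewrite /antisym_solution (beta_primitive_sym ab p0 q0) subrr.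
  by rewrite /antisym_solution /beta_primitive set_itv1 !Rintegral_set1 subrr.
- split.
    move=> x; rewrite in_itv/= => axb.
    have D := is_derive_antisym_solution p0 q0 axb; exact: ex_derive.
  apply: (@subspace_eq_continuous _ _ _
    (fun x => beta_weight a b p q x - beta_weight a b q p x)).
    move=> x /[!inE] xab; apply: esym.
    exact: (derive1_antisym_solution p0 q0 xab).
  apply: continuous_in_subspaceT => x /[!inE]/= xab.
  by apply: cvgB; exact: beta_weight_continuous.
- split.
    move=> x xab; apply/(derivable_withinE _ (nbx x xab)).
    by have D := dF x xab; exact: ex_derive.
  apply: (@subspace_eq_continuous _ _ _
    (fun x => c * (beta_weight a b (1 - q) (1 - p) x +
                   beta_weight a b (1 - p) (1 - q) x))).
    move=> x /[!inE] xab; apply: esym.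
    apply: etrans; first exact: (derive_withinE _ (nbx x xab)).
    by have D := dF x xab; rewrite derive1E derive_val.
  apply: continuous_in_subspaceT => x /[!inE]/= xab.
  apply: cvgM; first exact: cvg_cst.
  by apply: cvgD; exact: beta_weight_continuous.
- move=> x xab; rewrite /frac_operator /= !mul0r !addr0 mulNr; congr (- _).
  have -> : cst 1 \* frac_flux a b m 2^-1 2^-1 (antisym_solution a b p q) =
      frac_flux a b m 2^-1 2^-1 (antisym_solution a b p q).
    by apply/funext => y /=; rewrite mul1r.
  by have D := dF x xab; rewrite derive1E derive_val.
Qed.

End Assembly.

(** * Choice of the exponents and verification of the conditions *)

Theorem mainTheorem2 (R : realType) (a b mu t : R)
  (hab : a < b) (hmu : 0 < mu < 1) (ht : 1 + mu < t) :
  exists (alpha beta : R) (f p q k : R -> R),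
    [/\ [/\ 0 < alpha < 1, 0 < beta < 1 & alpha + beta = 1],
        [/\ Hstar a b f,
            C1_on `[a, b] p, C1_on `[a, b] q & C1_on `[a, b] k]
          /\ holder a b (derive_within `[a, b] p)
          /\ holder a b (derive_within `[a, b] k),
        (forall x, x \in `[a, b] -> 0 < k x)
          /\ (forall x, x \in `[a, b] ->
                0 <= q x / k x
                     - 2^-1 * derive_within `[a, b] (fun y => p y / k y) x),
        ((pi * (1 - mu ^+ 2) * cot ((1 + mu) * pi / 2))%:E
          + (4 * (b - a))%:E
            * Linfty_norm a b (fun x => (derive_within `[a, b] k x / k x)%R)
          < 0)%E &
        exists2 u : R -> R,
          true_solution a b mu alpha beta k p q f u &
          forall J : R -> R, Hstar a b J ->
            ~ (forall x, x \in `]a, b[ -> u x = fracint_left a t J x)].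
Proof.
have /andP[m0 m1] := hmu.
(* The midpoint of the admissible range, which is nonempty because [t > 1 + mu] and [mu < 1]. The
   bound [(1 + mu) / 2] makes [P < Q], and [mu < P] makes [Q < 1]. *)
pose P := (mu + Num.min (t - 1) ((1 + mu) / 2)) / 2.
have [mP Pt PQ] : [/\ mu < P, P <= t - 1 & P < (1 + mu) / 2].
  by rewrite /P; case: (leP (t - 1) ((1 + mu) / 2)) => tm; split; lra.
pose Q := 1 + mu - P.
have P01 : 0 < P < 1 by lra.
have Q01 : 0 < Q < 1 by rewrite /Q; lra.
have PQE : P + Q = 1 + mu by rewrite /Q; ring.
have [c uP] := antisym_true_solution hab P01 Q01 m1 PQE.
(* The source [f] is left open and is fixed by [uP], which is why the last condition is proved
   first. *)
exists 2^-1, 2^-1; eexists; exists (cst 0), (cst 0), (cst 1).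
split; last first.
- exists (antisym_solution a b P Q); first exact: uP.
  move=> J HJ; apply: antisym_solution_not_fracint HJ => //; rewrite /Q; lra.
- rewrite (@Linfty_norm_eq0 _ a b) ?mule0 ?adde0 ?lte_fin ?cot_half_lt0//.
  move=> x xab; rewrite derive_within_cst ?mul0r//.
  exact: subset_itv_oo_cc xab.
- split=> [x _|x xab]; first exact: ltr01.
  by rewrite (@derive_within_cst _ a b (0 / 1) x hab xab) mul0r mulr0 subrr.
- split; last by split; exact: holder_derive_within_cst.
  split; [|exact: C1_on_cst|exact: C1_on_cst|exact: C1_on_cst].
  by apply: Hstar_beta_weight => //; lra.
- by split; lra.
Qed.
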